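(* Let $\mathcal{S}$ be the algebra of symmetric functions, $\mathcal{D}$ the set of doubly symmetric functions, and $D:\mathcal{S}\to\mathcal{S}$ the linear map with $D(S_\lambda)=DS_\lambda:=\sum_{\mu\subseteq\lambda}S_\mu S_{(\lambda/\mu)'}$. Then: (1) $DS_{(n)}=2k_n$ for every $n\ge1$. (2) $DS_\lambda(x_1,\ldots,x_n)=HS_\lambda(x_1,\ldots,x_n;x_1,\ldots,x_n)$ for every partition $\lambda$ and all $n$. Hence, by linearity, $Df(X)=\digamma(f)(X;X)$ for all $f\in\mathcal{S}$ and all finite sets of variables $X$. (3) $DS_\lambda$ is doubly symmetric for every partition $\lambda$. Hence, by linearity, $D(\mathcal{S})\subseteq\mathcal{D}$. (4) $D$ is an algebra homomorphism. (5) If $*$ is the internal product of symmetric functions and $f$ is a (homogeneous) symmetric function of degree $n\ge 1$, then $D(f)=f*2k_n$.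
   Context: $\mathcal{S}$ is the algebra of symmetric functions over $\mathbb{Q}$, with basis the Schur functions $S_\lambda$ indexed by all partitions $\lambda$ (including the empty one). $S_{(\lambda/\mu)'}$ is the skew Schur function of the conjugate skew shape $(\lambda/\mu)'=\lambda'/\mu'$. For $n\ge1$, $k_n=\sum_{a+b=n,\ a\ge1,\ b\ge0}S_{(a,1^b)}$. The internal product $*$ is the bilinear product on homogeneous symmetric functions of degree $n$ with $p_\lambda*p_\mu=\delta_{\lambda\mu}z_\lambda p_\lambda$ for $\lambda,\mu\vdash n$, where $p_\lambda$ are the power sum symmetric functions and $z_\lambda=\prod_{i\ge1}i^{m_i}m_i!$, $m_i$ being the number of parts of $\lambda$ equal to $i$. Hook Schur functions: for finite, possibly empty, lists of variables $X=(x_1,\ldots,x_k)$, $Y=(y_1,\ldots,y_\ell)$, a $(k,\ell)$-semistandard tableau of shape $\lambda$ is a filling of the Young diagram of $\lambda$ with entries from the ordered alphabet $1<2<\cdots<k<1'<\cdots<\ell'$ such that entries are non-decreasing in each row and each column, unprimed symbols may repeat in rows but not in columns, and primed symbols may repeat in columns but not in rows. Then $HS_\lambda(X;Y)=\sum_T x^T$, summed over all such tableaux $T$, where $x^T=\prod_j x_j^{\#\{j \text{ in } T\}}\prod_j y_j^{\#\{j'\text{ in }T\}}$. The map $\digamma$ is the linear map sending $S_\lambda$ to $HS_\lambda$, so that for $f=\sum_\lambda m_\lambda S_\lambda$, $\digamma(f)(X;Y)=\sum_\lambda m_\lambda HS_\lambda(X;Y)$. A symmetric function $\sum_\lambda m_\lambda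 S_\lambda$ is doubly symmetric if for all finite (possibly empty) sets of variables $X,Y$ one has $\sum_\lambda m_\lambda S_\lambda(X,Y)=\sum_\lambda m_\lambda HS_\lambda(X;Y)$, where $S_\lambda(X,Y)$ is the Schur polynomial in all the variables of $X$ and $Y$ together. *)

(* Defs.v *)
From HB Require Import structures.
From mathcomp Require Import all_boot all_order all_fingroup all_algebra.
From mathcomp Require Import boolp mpoly.
From mathcomp Require Import zify.

Set Implicit Arguments.
Unset Strict Implicit.
Unset Printing Implicit Defensive.

Import GRing.Theory.
Local Open Scope ring_scope.

Definition is_part (s : seq nat) : bool := sorted geq s && (0%N \notin s).

Record part := Part { parts :> seq nat; _ : is_part parts }.
HB.instance Definition _ := [isSub for parts].
HB.instance Definition _ := [Countable of part by <:].

Lemma part_anti (la : part) i j :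
  (i <= j)%N -> (nth 0%N la j <= nth 0%N la i)%N.
Proof.
case: la => s /= /andP[ss _] le_ij.
have [lt_js|le_sj] := ltnP j (size s); last by rewrite (nth_default _ le_sj).
apply: (sorted_leq_nth (leT := geq)) => //.
- by move=> x y z; rewrite /geq /= => h1 h2; apply: leq_trans h2 h1.
- exact: leqnn.
- by rewrite inE; apply: leq_ltn_trans lt_js.
Qed.

Lemma part_head (la : part) i : (nth 0%N la i <= head 0%N la)%N.
Proof. by rewrite -nth0; apply: part_anti. Qed.

Lemma part_gt0 (la : part) i : (i < size la)%N -> (0 < nth 0%N la i)%N.
Proof.
case: la => s /= /andP[_ s0] lt_is.
by rewrite lt0n; apply: contra s0 => /eqP <-; apply: mem_nth.
Qed.

Definition empty_part : part := @Part [::] isT.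

Lemma row_partP n : is_part (nseq (0 < n)%N n).
Proof. by case: n. Qed.
Definition row_part n : part := Part (row_partP n).

(* The hook (a + 1, 1^b). *)
Lemma hook_partP a b : is_part (a.+1 :: nseq b 1%N).
Proof.
rewrite /is_part inE /= mem_nseq andbF andbT.
by case: b => //= b; elim: b.
Qed.
Definition hook_part a b : part := Part (hook_partP a b).

Lemma conj_partP (la : part) :
  is_part [seq count (fun p => i < p)%N la | i <- iota 0 (head 0%N la)].
Proof.
apply/andP; split.
- rewrite sorted_map; apply: (sub_sorted (e := leq)); last exact: iota_sorted.
  move=> i j /= le_ij; apply: sub_count => p /=; exact: leq_ltn_trans.
- apply/mapP => -[i]; rewrite mem_iota add0n /=; case: la => -[|a s] //= _ lt_ia.
  by rewrite lt_ia.
Qed.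

Definition conj_part (la : part) : part := Part (conj_partP la).

Definition part_sub (mu la : part) : bool :=
  all (fun i => nth 0 mu i <= nth 0 la i)%N (iota 0 (size mu)).

Lemma part_subP (mu la : part) :
  reflect (forall i, (nth 0 mu i <= nth 0 la i)%N) (part_sub mu la).
Proof.
apply: (iffP allP) => [h i|h i _]; last exact: h.
have [lt_i|le_i] := ltnP i (size mu); last by rewrite (nth_default _ le_i).
by apply: h; rewrite mem_iota.
Qed.

Fixpoint under (l : seq nat) : seq (seq nat) :=
  if l is a :: l' then
    [::] :: [seq b :: m | b <- iota 1 a, m <- under l']
  else [:: [::]].

Definition subparts (la : part) : seq part := pmap insub (under la).

Lemma mem_under l m : (m \in under l) =
  (0%N \notin m) && all (fun i => nth 0 m i <= nth 0 l i)%N (iota 0 (size m)).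
Proof.
elim: l m => [|a l IHl] [|b m] //=; rewrite !inE /=.
  by case: b => [|b] //=; rewrite andbF.
have -> : (b :: m \in [seq b0 :: m0 | b0 <- iota 1 a, m0 <- under l]) =
          (0 < b <= a)%N && (m \in under l).
  apply/allpairsP/andP => [[[x y] /= [hx hy [-> ->]]]|[hx hy]].
    by split=> //; move: hx; rewrite mem_iota add1n ltnS.
  by exists (b, m); split=> //=; rewrite mem_iota add1n ltnS.
rewrite IHl negb_or eq_sym -lt0n.
rewrite (iotaDl 1) all_map /=.
by case: (0 < b)%N; case: (0%N \notin m); case: (b <= a)%N; rewrite ?andbF.
Qed.

Lemma under_uniq l : uniq (under l).
Proof.
elim: l => //= a l IHl; apply/andP; split.
  by apply/allpairsP => -[[x y] []].
by apply: allpairs_uniq => //; [exact: iota_uniq | move=> [x y] [z t] _ _ [-> ->]].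
Qed.

Lemma mem_subparts (la mu : part) : (mu \in subparts la) = part_sub mu la.
Proof.
rewrite mem_pmap_sub mem_under /part_sub.
by case: mu => m /= /andP[_ ->].
Qed.

Lemma subparts_uniq la : uniq (subparts la).
Proof. exact/pmap_sub_uniq/under_uniq. Qed.

(* Cells (row, column), numbered from 0, of the diagram la minus mu. *)
Definition cell (la mu : part) :=
  {c : 'I_(size la) * 'I_(head 0%N la)
     | (nth 0 mu c.1 <= c.2)%N && (c.2 < nth 0 la c.1)%N}.

Definition crow la mu (c : cell la mu) : nat := (val c).1.
Definition ccol la mu (c : cell la mu) : nat := (val c).2.

(* The alphabet is 'I_N: the letters smaller than k are the unprimed ones,
   the others are primed.  For k = N there is no primed letter and these
   are the usual semistandard tableaux. *)
Definition is_tab N k la mu (T : {ffun cell la mu -> 'I_N}) : bool :=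
  [forall c, forall d,
     ((crow c == crow d) && (ccol c < ccol d)%N ==>
        (T c < T d)%N || (T c == T d) && (T c < k)%N)
  && ((ccol c == ccol d) && (crow c < crow d)%N ==>
        (T c < T d)%N || (T c == T d) && (k <= T c)%N)].

Definition tab_poly N k la mu : {mpoly rat[N]} :=
  \sum_(T : {ffun cell la mu -> 'I_N} | is_tab k T) \prod_c 'X_(T c).

(* HS_la(x_1, ..., x_k; y_1, ..., y_l), where x_i is the variable of index
   lshift l i and y_j the variable of index rshift k j. *)
Definition HS k l (la : part) : {mpoly rat[k + l]} :=
  tab_poly (k + l) k la empty_part.

(* The substitution y_i := x_i, giving p(x_1, ..., x_n; x_1, ..., x_n). *)
Definition diag n (p : {mpoly rat[n + n]}) : {mpoly rat[n]} :=
  p \mPo [tuple (match split i with inl j => 'X_j | inr j => 'X_j end)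
         | i < n + n].

(* By convention 0 unless mu is contained in la. *)
Definition skew_poly la mu N : {mpoly rat[N]} :=
  if part_sub mu la then tab_poly N N la mu else 0.

(* Bender-Knuth involutions: the skew Schur polynomials are symmetric. *)
Section BenderKnuth.

Variables (N : nat) (la mu : part).
Hypothesis sub_mu : forall i, (nth 0 mu i <= nth 0 la i)%N.
Implicit Types (T : {ffun cell la mu -> 'I_N}) (c d : cell la mu).

Local Notation lam := (nth 0%N la).
Local Notation mum := (nth 0%N mu).

Lemma cell_ge c : (mum (crow c) <= ccol c)%N.
Proof. by have /andP[] := valP c. Qed.
Lemma cell_lt c : (ccol c < lam (crow c))%N.
Proof. by have /andP[] := valP c. Qed.

Lemma cellP r x : (mum r <= x)%N -> (x < lam r)%N ->
  exists c, crow c = r /\ ccol c = x.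
Proof.
move=> h1 h2.
have hr : (r < size la)%N.
  by rewrite ltnNge; apply: contraTN h2 => /(nth_default 0%N) ->.
have hx : (x < head 0%N la)%N by apply: leq_trans h2 (part_head _ _).
have h : (mum (Ordinal hr) <= Ordinal hx)%N && (Ordinal hx < lam (Ordinal hr))%N
  by rewrite /= h1.
by exists (exist _ (Ordinal hr, Ordinal hx) h).
Qed.

Lemma ssytP T :
  reflect (forall c d,
     (crow c = crow d -> (ccol c < ccol d)%N -> (T c <= T d)%N) /\
     (ccol c = ccol d -> (crow c < crow d)%N -> (T c < T d)%N))
  (is_tab N T).
Proof.
apply: (iffP forallP) => [h c d|h c].
  have /forallP/(_ d)/andP[/implyP h1 /implyP h2] := h c; split=> e l.
    have := h1; rewrite e eqxx l => /(_ isT).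
    by rewrite -(inj_eq val_inj) /=; have := ltn_ord (T c); lia.
  have := h2; rewrite e eqxx l => /(_ isT).
  by rewrite -(inj_eq val_inj) /=; have := ltn_ord (T c); lia.
apply/forallP => d; have [h1 h2] := h c d.
apply/andP; split; apply/implyP => /andP[/eqP e l].
  by have := h1 e l; rewrite -(inj_eq val_inj) /= ltn_ord; lia.
by rewrite h2.
Qed.

(* bnd T r v is the column where the letters >= v start in row r. *)
Definition bnd T r v : nat :=
  maxn (mum r) (\max_(c | (crow c == r) && (T c < v)%N) (ccol c).+1).

Definition spec T (b : nat -> nat -> nat) :=
  (forall c v, (T c < v)%N = (ccol c < b (crow c) v)%N).

Lemma bnd_ge T r v : (mum r <= bnd T r v)%N.
Proof. exact: leq_maxl. Qed.

Lemma bnd_le T r v : (bnd T r v <= lam r)%N.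
Proof.
rewrite geq_max sub_mu; apply/bigmax_leqP => c /andP[/eqP <- _].
exact: cell_lt.
Qed.

Lemma bndP T r v : bnd T r v = mum r \/
  exists c, [/\ crow c = r, (T c < v)%N & bnd T r v = (ccol c).+1].
Proof.
rewrite /bnd; set m := \max_(_ | _) _.
have [le_m|lt_m] := leqP m (mum r); first by left; lia.
right.
have [c0 Pc0|P0] := pickP (fun c => (crow c == r) && (T c < v)%N); last first.
  by move: lt_m; rewrite /m big_pred0.
pose A := [pred c : cell la mu | (crow c == r) && (T c < v)%N].
have A0 : (0 < #|A|)%N by apply/card_gt0P; exists c0.
have [c /andP[/eqP h1 h2] h3] := eq_bigmax_cond (fun c => (ccol c).+1) A0.
have {}h3 : m = (ccol c).+1 by [].
by exists c; split=> //; lia.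
Qed.

Lemma bnd_gt T c v : (T c < v)%N -> (ccol c < bnd T (crow c) v)%N.
Proof.
move=> lt_v; rewrite leq_max; apply/orP; right.
pose A := [pred d : cell la mu | (crow d == crow c) && (T d < v)%N].
by apply: (@leq_bigmax_cond _ A (fun d => (ccol d).+1) c); rewrite inE eqxx.
Qed.

Lemma bnd_spec T : is_tab N T -> spec T (bnd T).
Proof.
move=> /ssytP tT c v; apply/idP/idP => [|lt_c]; first exact: bnd_gt.
have [e|[d [e1 e2 e3]]] := bndP T (crow c) v.
  by have := cell_ge c; lia.
move: lt_c; rewrite e3 ltnS leq_eqVlt => /orP[/eqP e|lt_cd].
  suff -> : c = d by [].
  by apply/val_inj; case: (c) (d) e e1 => -[[? ?] [? ?]] ? -[[[? ?] [? ?]] ?] /=;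
     rewrite /ccol /crow /= => ? ?; congr pair; apply/val_inj.
by apply: leq_ltn_trans e2; apply: (tT c d).1.
Qed.

Lemma spec_uniq T b : spec T (bnd T) -> spec T b ->
  (forall r v, mum r <= b r v <= lam r)%N -> bnd T =2 b.
Proof.
move=> s1 s2 hb r v; apply/eqP; rewrite eqn_leq.
have h1 := bnd_ge T r v; have h2 := bnd_le T r v.
have /andP[h3 h4] := hb r v.
apply/andP; split; rewrite leqNgt; apply/negP => lt_b.
  have [c [e1 e2]] := cellP h3 (leq_trans lt_b h2).
  by have := s1 c v; rewrite s2 e1 e2; lia.
have [c [e1 e2]] := cellP h1 (leq_trans lt_b h4).
by have := s1 c v; rewrite s2 e1 e2; lia.
Qed.

Lemma bnd_mono T r v w : (v <= w)%N -> (bnd T r v <= bnd T r w)%N.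
Proof.
move=> le_vw; have [->|[c [e1 e2 ->]]] := bndP T r v; first exact: bnd_ge.
by rewrite -e1; apply: bnd_gt; apply: leq_trans le_vw.
Qed.

Lemma bnd_inter T r v : is_tab N T -> (bnd T r.+1 v.+1 <= bnd T r v)%N.
Proof.
move=> tT; have [->|[d [e1 e2 ->]]] := bndP T r.+1 v.+1.
  by apply: leq_trans (bnd_ge _ _ _); apply: part_anti.
have [lt_m|ge_m] := ltnP (ccol d) (mum r).
  exact: leq_trans (bnd_ge _ _ _).
have lt_l : (ccol d < lam r)%N.
  by apply: leq_trans (cell_lt d) _; rewrite e1; apply: part_anti.
have [c [f1 f2]] := cellP ge_m lt_l.
rewrite -f2 -f1 -(bnd_spec tT); rewrite ltnS in e2; apply: leq_trans e2.
by apply: ((ssytP _ tT) c d).2; rewrite ?f2 // f1 e1.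
Qed.

Lemma spec_tab T b : spec T b ->
  (forall r v w, (v <= w)%N -> (b r v <= b r w)%N) ->
  (forall r v, (b r.+1 v.+1 <= b r v)%N) -> is_tab N T.
Proof.
move=> sT mono inter; apply/ssytP => c d; split=> e lt_cd.
  rewrite -ltnS sT e; apply: ltn_trans lt_cd _.
  by rewrite -(sT d).
rewrite sT e; apply: leq_trans (_ : b (crow d) (T d).+1 <= _)%N.
  by rewrite -sT.
have {lt_cd} : (crow c < crow d)%N by [].
elim: (crow d) => // r IHr; rewrite ltnS leq_eqVlt => /orP[/eqP->//|/IHr h].
by apply: leq_trans h; exact: leq_trans (inter _ _) (mono _ _ _ (leqnSn _)).
Qed.

Variable i : nat.
Hypothesis iN : (i.+1 < N)%N.

Definition lo T r := maxn (bnd T r i) (bnd T r.+1 i.+2).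
Definition hi T r :=
  if r is r'.+1 then minn (bnd T r i.+2) (bnd T r' i) else bnd T r i.+2.

Lemma lo_hi T r : is_tab N T ->
  (lo T r <= bnd T r i.+1 <= hi T r)%N.
Proof.
move=> tT; rewrite /lo /hi geq_max bnd_mono // bnd_inter //=.
by case: r => [|r]; rewrite ?leq_min bnd_mono // bnd_inter.
Qed.

Definition bnd' T r v :=
  if v == i.+1 then (lo T r + hi T r - bnd T r i.+1)%N else bnd T r v.

Lemma bnd'_bounds T r : is_tab N T ->
  [/\ lo T r <= bnd' T r i.+1, bnd' T r i.+1 <= hi T r,
      bnd T r i <= bnd' T r i.+1 & bnd' T r i.+1 <= bnd T r i.+2]%N.
Proof.
move=> tT; have := lo_hi r tT; rewrite /bnd' eqxx => h.
have : (bnd T r i <= lo T r)%N by rewrite leq_maxl.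
have : (hi T r <= bnd T r i.+2)%N by case: (r) => //= r'; rewrite geq_minl.
by split; lia.
Qed.

Definition bk T : {ffun cell la mu -> 'I_N} :=
  [ffun c => if (T c == i :> nat) || (T c == i.+1 :> nat) then
     (if (ccol c < bnd' T (crow c) i.+1)%N
      then Ordinal (ltnW iN) else Ordinal iN)
   else T c].

Lemma bk_spec T : is_tab N T -> spec (bk T) (bnd' T).
Proof.
move=> tT c v; rewrite ffunE.
have s w := bnd_spec tT c w.
have [_ _ h1 h2] := bnd'_bounds (crow c) tT.
have [->|ne_v] := eqVneq v i.+1.
  have := s i; have := s i.+2; have := ltnSn i.
  case: ifP => [/orP e|/norP[/eqP e1 /eqP e2]].
    by case: ifP => _ /=; rewrite ?ltnn ?ltnSn.
  by lia.
have -> : bnd' T (crow c) v = bnd T (crow c) v by rewrite /bnd' (negPf ne_v).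
rewrite -s; case: ifP => // /orP e.
by case: ifP => _ /=; move/eqP: ne_v; case: e => /eqP ->; lia.
Qed.

Lemma bk_tab T : is_tab N T -> is_tab N (bk T).
Proof.
move=> tT; apply: spec_tab (bk_spec tT) _ _ => [r|r v].
  apply: (homo_leq (r := leq)) => //; first exact: leq_trans.
  move=> v; have [_ _ h1 h2] := bnd'_bounds r tT.
  have [e|n1] := eqVneq v i; first by subst v; rewrite {1}/bnd' ltn_eqF.
  have [e|n2] := eqVneq v i.+1.
    by subst v; rewrite [X in (_ <= X)%N]/bnd' gtn_eqF.
  by rewrite /bnd' (negPf n2) eqSS (negPf n1) bnd_mono.
have [h1 _ h2 h3] := bnd'_bounds r tT.
have [_ h4 h5 h6] := bnd'_bounds r.+1 tT.
have [e|n1] := eqVneq v i.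
  subst v; rewrite [X in (_ <= X)%N]/bnd' ltn_eqF //.
  by apply: leq_trans h4 _; rewrite geq_minr.
have [e|n2] := eqVneq v i.+1.
  subst v; rewrite {1}/bnd' gtn_eqF //.
  by apply: leq_trans h1; rewrite leq_maxr.
by rewrite /bnd' (negPf n2) eqSS (negPf n1) bnd_inter.
Qed.

Lemma bk_bnd T : is_tab N T -> bnd (bk T) =2 bnd' T.
Proof.
move=> tT; apply: spec_uniq (bk_spec tT) _ => [|r v].
  exact/bnd_spec/bk_tab.
have [_ _ h1 h2] := bnd'_bounds r tT.
have [->|n1] := eqVneq v i.+1.
  by rewrite (leq_trans (bnd_ge T r i)) // (leq_trans h2 (bnd_le _ _ _)).
by rewrite /bnd' (negPf n1) bnd_ge bnd_le.
Qed.

Lemma bkK T : is_tab N T -> bk (bk T) = T.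
Proof.
move=> tT; have tT' := bk_tab tT.
have e : bnd' (bk T) =2 bnd T.
  move=> r v; have := lo_hi r tT; rewrite {1}/bnd'.
  have e1 w r' : w != i.+1 -> bnd (bk T) r' w = bnd T r' w.
    by move=> ne; rewrite bk_bnd // /bnd' (negPf ne).
  have n1 : i != i.+1 by rewrite ltn_eqF.
  have n2 : i.+2 != i.+1 by rewrite gtn_eqF.
  have -> : lo (bk T) r = lo T r by rewrite /lo !e1.
  have -> : hi (bk T) r = hi T r by rewrite /hi; case: r => [|r]; rewrite !e1.
  case: eqVneq => [-> h|ne _]; last by rewrite e1.
  by rewrite bk_bnd // /bnd' eqxx; lia.
apply/ffunP => c; apply/val_inj/eqP; rewrite eqn_leq /=.
have s v : (bk (bk T) c < v)%N = (T c < v)%N.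
  by rewrite (bk_spec tT') e (bnd_spec tT).
by rewrite -ltnS s ltnSn /= -ltnS -s ltnSn.
Qed.

Lemma card_interval n a b : (b <= n)%N ->
  #|[set x : 'I_n | a <= x < b]%N| = (b - a)%N.
Proof.
move=> le_bn; rewrite -sum1_card.
transitivity (\sum_(a <= x < b) 1)%N; last by rewrite sum_nat_const_nat muln1.
rewrite (big_nat_widen _ _ _ _ _ le_bn) big_geq_mkord.
by apply: eq_bigl => x; rewrite inE andbC.
Qed.

Lemma count_letter T (j : 'I_N) : is_tab N T ->
  #|[set c | T c == j]| =
  (\sum_(r < size la) (bnd T r j.+1 - bnd T r j))%N.
Proof.
move=> tT; rewrite -sum1_card.
rewrite (partition_big (fun c => (val c).1) predT) //=.
apply: eq_bigr => r _; rewrite sum1_card.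
rewrite -(@card_interval (head 0%N la)); last first.
  exact: leq_trans (bnd_le _ _ _) (part_head _ _).
transitivity #|[set c : cell la mu | (T c == j) && ((val c).1 == r)]|.
  by apply: eq_card => c; rewrite !inE unfold_in /= inE.
rewrite -(card_in_imset (f := fun c : cell la mu => (val c).2)); last first.
  move=> c d; rewrite !inE => /andP[_ /eqP e1] /andP[_ /eqP e2] e.
  by apply/val_inj; rewrite [val c]surjective_pairing [val d]surjective_pairing;
     rewrite /= e1 e2 e.
apply: eq_card => x; rewrite inE; apply/imsetP/idP => [[c]|/andP[h1 h2]].
  rewrite !inE => /andP[/eqP e /eqP <-] ->.
  have := bnd_spec tT c j; have := bnd_spec tT c j.+1.
  by rewrite e ltnn ltnSn /crow /ccol; lia.
have [c [e1 e2]] := cellP (leq_trans (bnd_ge T r j) h1)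
                          (leq_trans h2 (bnd_le T r j.+1)).
exists c; last by apply/val_inj.
rewrite !inE; apply/andP; split; last exact/eqP/val_inj.
apply/eqP/val_inj => /=; have := bnd_spec tT c j; have := bnd_spec tT c j.+1.
by rewrite e1 e2; lia.
Qed.

Lemma sum_lo_hi T :
  (\sum_(r < size la) (lo T r + hi T r) =
   \sum_(r < size la) (bnd T r i + bnd T r i.+2))%N.
Proof.
suff h m : (\sum_(r < m) (lo T r + hi T r) + minn (bnd T m i.+2) (bnd T m.-1 i)
   * (0 < m) =
   \sum_(r < m) (bnd T r i + bnd T r i.+2) + (bnd T m i.+2) * (0 < m))%N.
  have := h (size la); have := bnd_le T (size la) i.+2.
  rewrite nth_default // leqn0 => /eqP ->.
  by rewrite min0n !mul0n !addn0.
elim: m => [|m IHm]; first by rewrite !big_ord0 !muln0.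
rewrite !big_ord_recr /= !muln1; case: m IHm => [|m] /= IHm.
  by rewrite !big_ord0 /lo /hi; lia.
have -> : lo T m.+1 = maxn (bnd T m.+1 i) (bnd T m.+2 i.+2) by [].
by move: IHm; rewrite !muln1; lia.
Qed.

Let i0 := Ordinal (ltnW iN).
Let i1 := Ordinal iN.

Lemma bk_weight T (j : 'I_N) : is_tab N T ->
  #|[set c | bk T c == tperm i0 i1 j]| = #|[set c | T c == j]|.
Proof.
move=> tT; have tT' := bk_tab tT.
have eS : ((\sum_(r < size la) (bnd T r i.+2 - bnd' T r i.+1) =
           \sum_(r < size la) (bnd T r i.+1 - bnd T r i))%N *
  (\sum_(r < size la) (bnd' T r i.+1 - bnd T r i) =
           \sum_(r < size la) (bnd T r i.+2 - bnd T r i.+1))%N)%type.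
  have := sum_lo_hi T; rewrite !big_split /=.
  have e1 : (\sum_(r < size la) (bnd T r i.+2 - bnd' T r i.+1) +
             \sum_(r < size la) lo T r + \sum_(r < size la) hi T r =
             \sum_(r < size la) bnd T r i.+2 + \sum_(r < size la) bnd T r i.+1)%N.
    rewrite -!big_split; apply: eq_bigr => r _ /=.
    have := lo_hi r tT; have [] := bnd'_bounds r tT; rewrite /bnd' eqxx.
    by lia.
  have e2 : (\sum_(r < size la) (bnd' T r i.+1 - bnd T r i) +
             \sum_(r < size la) bnd T r i + \sum_(r < size la) bnd T r i.+1 =
             \sum_(r < size la) lo T r + \sum_(r < size la) hi T r)%N.
    rewrite -!big_split; apply: eq_bigr => r _ /=.
    have := lo_hi r tT; have [] := bnd'_bounds r tT; rewrite /bnd' eqxx.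
    by lia.
  have e3 : (\sum_(r < size la) (bnd T r i.+2 - bnd T r i.+1) +
             \sum_(r < size la) bnd T r i.+1 = \sum_(r < size la) bnd T r i.+2)%N.
    rewrite -!big_split; apply: eq_bigr => r _ /=.
    by rewrite subnK // bnd_mono.
  have e4 : (\sum_(r < size la) (bnd T r i.+1 - bnd T r i) +
             \sum_(r < size la) bnd T r i = \sum_(r < size la) bnd T r i.+1)%N.
    rewrite -!big_split; apply: eq_bigr => r _ /=.
    by rewrite subnK // bnd_mono.
  move: e1 e2 e3 e4; do 9!move: (bigop _ _ _) => ?.
  by move=> e1 e2 e3 e4 e5; split; lia.
rewrite !count_letter //.
under eq_bigr do rewrite !bk_bnd //.
case: tpermP => [->|->|ne0 ne1].
- rewrite /= -eS.1; apply: eq_bigr => r _.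
  by rewrite [bnd' T r i.+2]/bnd' gtn_eqF.
- rewrite /= -eS.2; apply: eq_bigr => r _.
  by rewrite [bnd' T r i]/bnd' ltn_eqF.
apply: eq_bigr => r _; rewrite /bnd'.
have -> : (j.+1 == i.+1) = false.
  by apply/eqP => -[e]; apply: ne0; apply/val_inj.
by have -> : (j == i.+1 :> nat) = false by apply/eqP => e; apply: ne1; apply/val_inj.
Qed.

Lemma prod_letters T (F : 'I_N -> {mpoly rat[N]}) :
  \prod_c F (T c) = \prod_j F j ^+ #|[set c | T c == j]|.
Proof.
rewrite (partition_big T predT) //=; apply: eq_bigr => j _.
rewrite (eq_bigr (fun _ => F j)) => [|c /eqP -> //].
by rewrite prodr_const; congr (_ ^+ _); apply: eq_card => c; rewrite !inE.
Qed.

Lemma msym_tab_poly_adj :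
  msym (tperm i0 i1) (tab_poly N N la mu) = tab_poly N N la mu.
Proof.
rewrite /tab_poly raddf_sum /=.
rewrite [RHS](reindex_onto bk bk) => [|T tT]; last exact: bkK.
apply: eq_big => [T|T tT].
  apply/idP/andP => [tT|[tT /eqP <-]]; last exact: bk_tab.
  by rewrite bk_tab // bkK.
rewrite rmorph_prod /=.
rewrite (prod_letters _ (fun j => 'X_j)).
rewrite (reindex_inj (@perm_inj _ (tperm i0 i1))) /=.
under [RHS]eq_bigr do rewrite bk_weight //.
rewrite -(prod_letters _ (fun j => 'X_(tperm i0 i1 j))).
apply: eq_bigr => c _; rewrite msymX; congr 'X_[_].
by apply/mnmP => x; rewrite mnmE !mnm1E tpermV -{2}(tpermK i0 i1 x) (inj_eq perm_inj).
Qed.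

End BenderKnuth.

Lemma adj_symmetric N (p : {mpoly rat[N]}) :
  (forall i (iN : (i.+1 < N)%N),
     msym (tperm (Ordinal (ltnW iN)) (Ordinal iN)) p = p) ->
  p \is symmetric.
Proof.
move=> adj.
have tp d : forall a b : 'I_N, (b = a + d.+1 :> nat)%N -> msym (tperm a b) p = p.
  elim: d => [|d IHd] a b e.
    have bN := ltn_ord b; have lt1 : (a.+1 < N)%N by lia.
    have -> : a = Ordinal (ltnW lt1) by apply/val_inj.
    have -> : b = Ordinal lt1 by apply/val_inj => /=; lia.
    exact: adj.
  have bN := ltn_ord b; have lt1 : (a + d.+1 < N)%N by lia.
  have lt2 : ((a + d.+1).+1 < N)%N by lia.
  pose c := Ordinal lt1.
  have eb : b = Ordinal lt2 by apply/val_inj => /=; lia.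
  have ec : c = Ordinal (ltnW lt2) by apply/val_inj.
  have e2 : msym (tperm c b) p = p by rewrite eb ec; apply: adj.
  have -> : tperm a b = (tperm c b * tperm a c * tperm c b)%g.
    rewrite -{1}[tperm c b]tpermV -mulgA -conjgE tpermJ tpermD ?tpermL //.
      by rewrite -val_eqE /=; lia.
    by rewrite -val_eqE /=; lia.
  by rewrite !msymMm e2 (IHd a c) //.
apply/issymP => s; have [ts -> _] := prod_tpermP s.
elim: ts => [|t ts IHts]; first by rewrite big_nil msym1m.
rewrite big_cons msymMm; suff -> : msym (tperm t.1 t.2) p = p by [].
have [lt_t|lt_t|/val_inj ->] := ltngtP t.1 t.2.
- by apply: (tp (t.2 - t.1).-1); lia.
- by rewrite tpermC; apply: (tp (t.1 - t.2).-1); lia.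
- by rewrite tperm1 msym1m.
Qed.

Lemma skew_poly_sym la mu N : skew_poly la mu N \is symmetric.
Proof.
rewrite /skew_poly; case: part_subP => [sub|_]; last exact: rpred0.
by apply: adj_symmetric => i iN; apply: msym_tab_poly_adj.
Qed.

(* The substitution x_{n+1} := 0. *)
Definition kill_last n (p : {mpoly rat[n.+1]}) : {mpoly rat[n]} :=
  p \mPo [tuple (if unlift ord_max i is Some j then 'X_j else 0) | i < n.+1].

(* Symmetric functions in infinitely many variables, as the graded inverse
   limit of the rings of symmetric polynomials: f n is f(x_1, ..., x_n). *)
Definition is_symfun (f : forall n, {mpoly rat[n]}) : Prop :=
  [/\ forall n, f n \is symmetric,
      forall n, kill_last (f n.+1) = f n
    & exists d, forall n, (msize (f n) <= d)%N].

Record symfun := SymFun {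
  symfun_val :> forall n, {mpoly rat[n]};
  symfunP : is_symfun symfun_val }.

Lemma symfun_eq (f g : symfun) : (forall n, f n = g n) -> f = g.
Proof.
case: f g => f Pf [g Pg] /= e.
have ef : f = g by apply: functional_extensionality_dep.
by case: _ / ef Pg => Pg; rewrite (Prop_irrelevance Pf Pg).
Qed.

HB.instance Definition _ := gen_eqMixin symfun.
HB.instance Definition _ := gen_choiceMixin symfun.

Lemma zero_symfunP : is_symfun (fun n => 0).
Proof.
split=> [n|n|]; [exact: rpred0 | exact: raddf0 |].
by exists 0%N => n; rewrite msize0.
Qed.

Lemma one_symfunP : is_symfun (fun n => 1).
Proof.
split=> [n|n|]; [exact: rpred1 | exact: rmorph1 |].
by exists 1%N => n; rewrite msize1.
Qed.

Lemma opp_symfunP (f : symfun) : is_symfun (fun n => - f n).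
Proof.
case: (symfunP f) => h1 h2 [d h3]; split=> [n|n|].
- by rewrite rpredN; apply: h1.
- by rewrite /kill_last raddfN /= -/(kill_last _) h2.
- by exists d => n; rewrite msizeN.
Qed.

Lemma add_symfunP (f g : symfun) : is_symfun (fun n => f n + g n).
Proof.
case: (symfunP f) (symfunP g) => h1 h2 [d h3] [h4 h5 [e h6]]; split=> [n|n|].
- by apply: rpredD; [apply: h1 | apply: h4].
- by rewrite /kill_last raddfD /= -!/(kill_last _) h2 h5.
- exists (maxn d e) => n; apply: leq_trans (msizeD_le _ _) _.
  by rewrite geq_max !leq_max h3 h6 orbT.
Qed.

Lemma mul_symfunP (f g : symfun) : is_symfun (fun n => f n * g n).
Proof.
case: (symfunP f) (symfunP g) => h1 h2 [d h3] [h4 h5 [e h6]]; split=> [n|n|].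
- by apply: rpredM; [apply: h1 | apply: h4].
- by rewrite /kill_last rmorphM /= -!/(kill_last _) h2 h5.
- exists (d + e)%N => n.
  have [->|nf] := eqVneq (f n) 0; first by rewrite mul0r msize0.
  have [->|ng] := eqVneq (g n) 0; first by rewrite mulr0 msize0.
  by rewrite msizeM // (leq_trans (leq_pred _)) // leq_add.
Qed.

Lemma scale_symfunP (a : rat) (f : symfun) : is_symfun (fun n => a *: f n).
Proof.
case: (symfunP f) => h1 h2 [d h3]; split=> [n|n|].
- by apply: rpredZ; apply: h1.
- by rewrite /kill_last linearZ /= -/(kill_last _) h2.
- by exists d => n; apply: leq_trans (msizeZ_le _ _) _.
Qed.

Definition symfun_zero := SymFun zero_symfunP.
Definition symfun_one := SymFun one_symfunP.
Definition symfun_opp f := SymFun (opp_symfunP f).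
Definition symfun_add f g := SymFun (add_symfunP f g).
Definition symfun_mul f g := SymFun (mul_symfunP f g).
Definition symfun_scale a f := SymFun (scale_symfunP a f).

Fact symfun_addA : associative symfun_add.
Proof. by move=> f g h; apply: symfun_eq => n /=; rewrite addrA. Qed.
Fact symfun_addC : commutative symfun_add.
Proof. by move=> f g; apply: symfun_eq => n /=; rewrite addrC. Qed.
Fact symfun_add0 : left_id symfun_zero symfun_add.
Proof. by move=> f; apply: symfun_eq => n /=; rewrite add0r. Qed.
Fact symfun_addN : left_inverse symfun_zero symfun_opp symfun_add.
Proof. by move=> f; apply: symfun_eq => n /=; rewrite addNr. Qed.
HB.instance Definition _ := GRing.isZmodule.Build symfun
  symfun_addA symfun_addC symfun_add0 symfun_addN.

Fact symfun_mulA : associative symfun_mul.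
Proof. by move=> f g h; apply: symfun_eq => n /=; rewrite mulrA. Qed.
Fact symfun_mulC : commutative symfun_mul.
Proof. by move=> f g; apply: symfun_eq => n /=; rewrite mulrC. Qed.
Fact symfun_mul1 : left_id symfun_one symfun_mul.
Proof. by move=> f; apply: symfun_eq => n /=; rewrite mul1r. Qed.
Fact symfun_mulDl : left_distributive symfun_mul symfun_add.
Proof. by move=> f g h; apply: symfun_eq => n /=; rewrite mulrDl. Qed.
Fact symfun_one_neq0 : symfun_one != 0.
Proof.
apply/eqP => /(congr1 (fun f : symfun => f 0%N)) /= /eqP.
by rewrite oner_eq0.
Qed.
HB.instance Definition _ := GRing.Zmodule_isComNzRing.Build symfun
  symfun_mulA symfun_mulC symfun_mul1 symfun_mulDl symfun_one_neq0.

Fact symfun_scaleA a b f :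
  symfun_scale a (symfun_scale b f) = symfun_scale (a * b) f.
Proof. by apply: symfun_eq => n /=; rewrite scalerA. Qed.
Fact symfun_scale1 : left_id 1 symfun_scale.
Proof. by move=> f; apply: symfun_eq => n /=; rewrite scale1r. Qed.
Fact symfun_scaleDr : right_distributive symfun_scale +%R.
Proof. by move=> a f g; apply: symfun_eq => n /=; rewrite scalerDr. Qed.
Fact symfun_scaleDl f : {morph symfun_scale^~ f : a b / a + b}.
Proof. by move=> a b; apply: symfun_eq => n /=; rewrite scalerDl. Qed.
HB.instance Definition _ := GRing.Zmodule_isLmodule.Build rat symfun
  symfun_scaleA symfun_scale1 symfun_scaleDr symfun_scaleDl.

Fact symfun_scaleAl (a : rat) (f g : symfun) : a *: (f * g) = (a *: f) * g.
Proof. by apply: symfun_eq => n /=; rewrite scalerAl. Qed.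
HB.instance Definition _ := GRing.Lmodule_isLalgebra.Build rat symfun
  symfun_scaleAl.
HB.instance Definition _ := GRing.Lalgebra_isComAlgebra.Build rat symfun.

Lemma kill_last_tab_poly la mu n :
  kill_last (tab_poly n.+1 n.+1 la mu) = tab_poly n n la mu.
Proof.
rewrite /kill_last /tab_poly raddf_sum /=.
set t := [tuple _ | i < n.+1].
have tE i : 'X_i \mPo t = if unlift ord_max i is Some j then 'X_j else 0.
  by rewrite comp_mpolyXU -tnth_nth tnth_mktuple.
under eq_bigr => T _.
  rewrite rmorph_prod /=; under eq_bigr do rewrite tE.
  over.
pose w (T : {ffun cell la mu -> 'I_n}) := [ffun c => lift ord_max (T c)].
have w_inj : injective w.
  move=> T U /ffunP e; apply/ffunP => c; have := e c.
  by rewrite !ffunE => /lift_inj.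
have w_tab T : is_tab n.+1 (w T) = is_tab n T.
  apply: eq_forallb => c; apply: eq_forallb => d.
  rewrite !ffunE (inj_eq lift_inj) !lift_max.
  have h1 := ltn_ord (T c); have h2 : (T c < n.+1)%N by apply: ltnW.
  by rewrite h1 h2 !(leqNgt _ (T c)) h1 h2.
rewrite (bigID (fun T => T \in [set w U | U : {ffun cell la mu -> 'I_n}])) /=.
rewrite [X in _ + X]big1 ?addr0 => [|T /andP[_ nT]]; last first.
  suff [c Tc] : exists c, T c = ord_max.
    by rewrite (bigD1 c) //= Tc unlift_none mul0r.
  have [c /eqP Tc|h] := pickP (fun c => T c == ord_max); first by exists c.
  have lt_n c : (T c < n)%N.
    by rewrite ltn_neqAle -ltnS ltn_ord andbT; have := h c; rewrite -val_eqE => ->.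
  case/imsetP: nT; exists [ffun c => Ordinal (lt_n c)] => //.
  by apply/ffunP => c; apply/val_inj; rewrite !ffunE /= /bump leqNgt lt_n.
rewrite (eq_bigl (fun T => (T \in [set w U | U : {ffun cell la mu -> 'I_n}])
    && is_tab n.+1 T)); last by move=> T; rewrite andbC.
rewrite big_imset_cond /=; last by move=> T U _ _ /w_inj.
apply: eq_big => [T|T _]; first by rewrite w_tab.
by apply: eq_bigr => c _; rewrite ffunE liftK.
Qed.

Lemma skew_polyP la mu : is_symfun (skew_poly la mu).
Proof.
split=> [n|n|]; first exact: skew_poly_sym.
  rewrite /skew_poly; case: ifP => _; first exact: kill_last_tab_poly.
  by rewrite /kill_last raddf0.
exists #|{: cell la mu}|.+1 => n.
rewrite /skew_poly; case: ifP => _; last by rewrite msize0.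
apply: leq_trans (msize_sum _ _ _) _; apply/bigmax_leqP_seq => T _ _.
by rewrite mprodXE msizeX mdeg_sum (eq_bigr (fun=> 1%N)) ?sum1_card // => c _;
   rewrite mdeg1.
Qed.

Definition skew_schur la mu : symfun := SymFun (skew_polyP la mu).

Definition schur la : symfun := skew_schur la empty_part.

Definition DS la : symfun :=
  \sum_(mu <- subparts la)
     schur mu * skew_schur (conj_part la) (conj_part mu).

Definition k_fun n : symfun := \sum_(b < n) schur (hook_part (n - b).-1 b).

Lemma psumP k : is_symfun (fun n => \sum_(i < n) 'X_i ^+ k.+1).
Proof.
split=> [n|n|].
- apply/issymP => s; rewrite raddf_sum /= [RHS](reindex_inj (@perm_inj _ s)).
  apply: eq_bigr => i _; rewrite rmorphXn /= msymX; congr ('X_[_] ^+ _).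
  by apply/mnmP => x; rewrite mnmE !mnm1E -{2}(permKV s x) (inj_eq perm_inj).
- rewrite /kill_last raddf_sum big_ord_recr /=.
  rewrite rmorphXn /= comp_mpolyXU -tnth_nth tnth_mktuple unlift_none.
  rewrite expr0n addr0; apply: eq_bigr => i _.
  rewrite rmorphXn /= comp_mpolyXU -tnth_nth tnth_mktuple.
  by rewrite (_ : widen_ord _ i = lift ord_max i) ?liftK //;
     apply/val_inj; rewrite /= /bump leqNgt ltn_ord.
- exists k.+2 => n; apply: leq_trans (msize_sum _ _ _) _.
  apply/bigmax_leqP => i _.
  by rewrite mpolyXn msizeX mdegMn mdeg1 mul1n.
Qed.

(* psum k is the power sum p_(k + 1). *)
Definition psum k : symfun := SymFun (psumP k).

Definition psum_part (la : part) : symfun := \prod_(a <- la) psum a.-1.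

Definition zcoef (la : part) : nat :=
  (\prod_(1 <= i < (head 0 la).+1)
      (i ^ count_mem i la * (count_mem i la)`!))%N.

Definition homogeneous d (f : symfun) : Prop :=
  forall n, f n \is d.-homog.

(* star is the internal product on the homogeneous component of degree d;
   nothing is assumed about star outside this component. *)
Definition internal_product d (star : symfun -> symfun -> symfun) : Prop :=
  [/\ forall f g, homogeneous d f -> homogeneous d g ->
        homogeneous d (star f g),
      forall (a : rat) f g h,
        homogeneous d f -> homogeneous d g -> homogeneous d h ->
        star (a *: f + g) h = a *: star f h + star g h,
      forall (a : rat) f g h,
        homogeneous d f -> homogeneous d g -> homogeneous d h ->
        star h (a *: f + g) = a *: star h f + star h g
    & forall la mu : part, sumn la = d -> sumn mu = d ->
        star (psum_part la) (psum_part mu) =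
        if la == mu then psum_part la *+ zcoef la else 0].

(* S_la(X, Y) is the polynomial schur la (k + l) in the k + l variables of
   HS k l la. *)
Definition doubly_symmetric (f : symfun) : Prop :=
  exists (s : seq part) (m : part -> rat),
    f = \sum_(la <- s) m la *: schur la /\
    forall k l, \sum_(la <- s) m la *: schur la (k + l)%N =
                \sum_(la <- s) m la *: HS k l la.

(* Main.v *)
From HB Require Import structures.
Require Import Defs.
From mathcomp Require Import all_boot all_order all_fingroup all_algebra.
From mathcomp Require Import mpoly.
From mathcomp Require Import zify ring.

(** Adding one letter to the alphabet removes a horizontal strip (unprimed
    letter) or a vertical strip (primed letter) from the shape of a tableau.
    Cutting the (n,n)-tableaux of shape la after the unprimed letters and
    transposing the primed part gives DS_la(X) = HS_la(X;X).

    The signed count of the ways to remove a horizontal and then a vertical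
    strip from la, leaving nu, vanishes unless nu = la; hence removing
    horizontal strips with weight -y undoes the addition of a primed letter y.
    Removing horizontal strips is the substitution f(X) |-> f(X, t), a ring
    morphism, so by induction on the number of primed letters and on the degree
    the map S_la |-> HS_la(X;Y) is a ring morphism, sending p_r to
    p_r(X) - (-1)^r p_r(Y).  Therefore D is a ring morphism multiplying p_r by
    1 - (-1)^r, and (3) and (5) can be checked on products of power sums, which
    span the symmetric functions, using h_n = sum_la z_la^-1 p_la for (5).  Part
    (1) compares the recurrences in the number of variables of
    sum_j h_j e_(n-j) and of the sum of the hook Schur polynomials. *)

Set Implicit Arguments.
Unset Strict Implicit.
Unset Printing Implicit Defensive.

Import Order.TTheory GRing.Theory Num.Theory.
Local Open Scope ring_scope.

(** * Removing the largest letter of a tableau *)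

(** The obstacle is (4): superization is prescribed only on Schur functions, and their products are
    never computed. Setting t = -y in f(X, t) is multiplicative by nature and relates superization
    in N letters to superization in N + 1 letters, the latter being applied to the coefficients of
    the expansion in t. The coefficients of positive powers of t have smaller degree, so the only
    unknown value is the one at f itself; this is what closes the double induction.

    For (5), h_n is the unit of the internal product and (1) says that D(h_n) = 2 k_n. The claim
    therefore reads D(f) = f * D(h_n), which holds for every linear map having the p_la as
    eigenvectors.

    A symmetric function of degree at most d is determined by its value in d variables. The spanning
    statements are thus reduced to polynomials in d variables, where leading monomials and the
    fundamental theorem are available. *)

Lemma part_ext (la mu : part) : (forall i, nth 0%N la i = nth 0%N mu i) -> la = mu.
Proof.
move=> e; apply/val_inj/(@eq_from_nth _ 0%N) => [|i _]; last exact: e.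
wlog suff W : la mu e / (size la <= size mu)%N.
  by apply/eqP; rewrite eqn_leq !W.
rewrite leqNgt; apply/negP => lt_s; have := Defs.part_gt0 lt_s.
by rewrite e nth_default.
Qed.

(* The partition with parts f 0, f 1, ..., for f weakly decreasing and
   vanishing at L. *)
Definition part_of_fun (f : nat -> nat) L : part :=
  insubd empty_part (mkseq f (find (fun r => f r == 0%N) (iota 0 L.+1))).

(** The list stops at the first zero of [f], found at [L] at the latest; from there on [f] vanishes
    by monotonicity, in agreement with the default value of [nth]. *)
Lemma nth_part_of_fun (f : nat -> nat) L : (forall r, f r.+1 <= f r)%N ->
  f L = 0%N -> forall r, nth 0%N (part_of_fun f L) r = f r.
Proof.
move=> f_dec fL r.
have f_mono i j : (i <= j)%N -> (f j <= f i)%N.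
  move=> /subnK <-; elim: (j - i)%N => [|k IHk]; rewrite ?add0n // addSn.
  exact: leq_trans (f_dec _) IHk.
rewrite /part_of_fun; set M := find _ _.
have hasL : has (fun r => f r == 0%N) (iota 0 L.+1).
  by apply/hasP; exists L; rewrite ?mem_iota ?fL /=.
have ltM : (M < L.+1)%N by rewrite -[X in (_ < X)%N](size_iota 0) -has_find.
have fM : f M = 0%N.
  by have := nth_find 0%N hasL; rewrite nth_iota // => /eqP.
have gtM i : (i < M)%N -> f i != 0%N.
  move=> lt_i; have := before_find 0%N lt_i.
  by rewrite nth_iota ?(ltn_trans lt_i) // => ->.
have partM : is_part (mkseq f M).
  apply/andP; split.
    apply: (homo_sorted (e := leq)); last exact: iota_sorted.
    by move=> i j; apply: f_mono.
  apply/mapP => -[i]; rewrite mem_iota /= add0n => lt_i e.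
  by have := gtM i lt_i; rewrite -e.
rewrite insubdK //; have [lt_r|le_r] := ltnP r M; first by rewrite nth_mkseq.
rewrite nth_default ?size_mkseq //; apply/esym/eqP.
by rewrite -leqn0 -fM f_mono.
Qed.

Lemma part_sub_trans (nu la mu : part) :
  part_sub mu nu -> part_sub nu la -> part_sub mu la.
Proof.
by move=> /part_subP h1 /part_subP h2; apply/part_subP => i; apply: leq_trans (h2 i).
Qed.

Lemma part_sub_refl (la : part) : part_sub la la.
Proof. by apply/part_subP. Qed.

Lemma part_sub0 (la : part) : part_sub empty_part la.
Proof. by []. Qed.

Lemma part_sub_size (mu la : part) : part_sub mu la -> (size mu <= size la)%N.
Proof.
move=> /part_subP h; rewrite leqNgt; apply/negP => lt_s.
have := h (size la); rewrite [nth 0%N la _]nth_default // leqn0 => /eqP e.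
by have := Defs.part_gt0 lt_s; rewrite e.
Qed.

(** The free bound [L] allows nested partitions to be compared row by row over one range. *)
Lemma sumn_part (la : part) L : (size la <= L)%N ->
  sumn la = (\sum_(r < L) nth 0 la r)%N.
Proof.
move=> le_L; rewrite sumnE (big_nth 0%N) big_mkord (big_ord_widen _ _ le_L).
rewrite big_mkcond; apply: eq_bigr => r _; case: ltnP => // h.
by rewrite nth_default.
Qed.

Lemma part_sub_sumn (mu la : part) : part_sub mu la -> (sumn mu <= sumn la)%N.
Proof.
move=> s; rewrite (sumn_part (part_sub_size s)) (sumn_part (leqnn _)).
by apply: leq_sum => r _; move/part_subP: s.
Qed.

(* Horizontal strips for h = true, vertical strips for h = false. *)
Definition strip (h : bool) (la nu : part) : bool :=
  part_sub nu la &&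
  all (fun r => if h then nth 0 la r.+1 <= nth 0 nu r
                else nth 0 la r <= (nth 0 nu r).+1)%N (iota 0 (size la)).

Lemma stripP h (la nu : part) :
  reflect ((forall r, nth 0 nu r <= nth 0 la r)%N /\
           (forall r, if h then nth 0 la r.+1 <= nth 0 nu r
                      else nth 0 la r <= (nth 0 nu r).+1)%N)
    (strip h la nu).
Proof.
apply: (iffP andP) => [[/part_subP h1 /allP h2]|[h1 h2]]; split=> //.
- move=> r; have [lt_r|le_r] := ltnP r (size la).
    by apply: h2; rewrite mem_iota.
  by case: (h); rewrite nth_default // leqW.
- exact/part_subP.
- by apply/allP => r _.
Qed.

Lemma strip_sub h la nu : strip h la nu -> part_sub nu la.
Proof. by case/andP. Qed.

Lemma cell_eq la mu (c d : cell la mu) :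
  crow c = crow d -> ccol c = ccol d -> c = d.
Proof.
move=> e1 e2; apply/val_inj; rewrite [val c]surjective_pairing.
by rewrite [val d]surjective_pairing; congr (_, _); apply/val_inj.
Qed.

Lemma card_cell (la mu : part) : part_sub mu la ->
  #|{: cell la mu}| = (sumn la - sumn mu)%N.
Proof.
move=> s; have /part_subP h := s.
rewrite (sumn_part (leqnn (size la))) (sumn_part (part_sub_size s)).
rewrite -sumnB; last by move=> r _; apply: h.
rewrite card_sig -sum1_card.
rewrite (partition_big (fun c : 'I_(size la) * 'I_(head 0%N la) => c.1) predT) //=.
apply: eq_bigr => r _; rewrite -(@card_interval (head 0%N la)) ?part_head //.
rewrite -sum1_card (reindex_onto (fun x => (r, x)) snd) /=.
  by apply: eq_bigl => x; rewrite !inE /= !eqxx !andbT.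
by move=> [r' x] /= /andP[_ /eqP ->].
Qed.

Lemma is_tabP N k la mu (T : {ffun cell la mu -> 'I_N}) :
  reflect (forall c d,
     (crow c = crow d -> (ccol c < ccol d)%N ->
       (T c < T d)%N \/ (T c = T d :> nat) /\ (T c < k)%N) /\
     (ccol c = ccol d -> (crow c < crow d)%N ->
       (T c < T d)%N \/ (T c = T d :> nat) /\ (k <= T c)%N))
  (is_tab k T).
Proof.
apply: (iffP forallP) => [h c d|h c].
  have /forallP/(_ d)/andP[/implyP h1 /implyP h2] := h c; split=> e l.
    have := h1; rewrite e eqxx l => /(_ isT) /orP[->|/andP[/eqP -> ->]]; by [left|right].
  have := h2; rewrite e eqxx l => /(_ isT) /orP[->|/andP[/eqP -> ->]]; by [left|right].
apply/forallP => d; have [h1 h2] := h c d.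
apply/andP; split; apply/implyP => /andP[/eqP e l].
  by case: (h1 e l) => [->//|[/val_inj -> ->]]; rewrite eqxx orbT.
by case: (h2 e l) => [->//|[/val_inj -> ->]]; rewrite eqxx orbT.
Qed.

(* Variables indexed by nat avoid casts between alphabets of different sizes. *)
Definition tabsum (A : comNzRingType) N k (la mu : part) (x : nat -> A) : A :=
  \sum_(T : {ffun cell la mu -> 'I_N} | is_tab k T) \prod_c x (T c).

Lemma eq_tabsum (A : comNzRingType) N k la mu (x y : nat -> A) :
  (forall i, (i < N)%N -> x i = y i) -> tabsum N k la mu x = tabsum N k la mu y.
Proof. by move=> e; apply: eq_bigr => T _; apply: eq_bigr => c _; apply: e. Qed.

Lemma tabsum_all N k la mu (A : comNzRingType) (x : nat -> A) : (N <= k)%N ->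
  tabsum N k la mu x = tabsum N N la mu x.
Proof.
move=> le_Nk; apply: eq_bigl => T; apply: eq_forallb => c; apply: eq_forallb => d.
have lt_N := ltn_ord (T c); have lt_k := leq_trans lt_N le_Nk.
by rewrite !(leqNgt _ (T c)) lt_N lt_k.
Qed.

(** The class of [i] is given by a relation with a unique solution in [s] instead of a function: the
    shape left by a tableau is characterised by [fits], and [tab_shape] shows that it exists. *)
Lemma partition_big_seq (R : nmodType) (I : finType) (J : eqType) (s : seq J)
    (P : pred I) (Q : pred J) (r : I -> J -> bool) (F : I -> R) :
  uniq s ->
  (forall i, P i -> exists j, [/\ j \in s, Q j &
     forall j', j' \in s -> Q j' -> r i j' = (j' == j)]) ->
  \sum_(i | P i) F i = \sum_(j <- s | Q j) \sum_(i | P i && r i j) F i.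
Proof.
move=> us h; rewrite (exchange_big_dep P) /=; last by move=> ? ? _ /andP[].
apply: eq_bigr => i Pi; have [j [js Qj e]] := h i Pi.
rewrite (big_rem j) //= Qj Pi e // eqxx big_seq_cond big1 ?addr0 // => j'.
rewrite mem_rem_uniq // inE => /andP[/andP[/= ne js'] /andP[Qj']].
by rewrite e // (negPf ne).
Qed.

Section Branching.

Variables (N k : nat) (la mu : part).
Hypothesis sub_mu : part_sub mu la.

Let fits (T : {ffun cell la mu -> 'I_N.+1}) (nu : part) :=
  [forall c, (T c < N)%N == (ccol c < nth 0 nu (crow c))%N].

(** The shape is read off the row boundaries [bnd T r N]. All cells outside it carry the letter [N],
    which may repeat in rows only if it is unprimed ([N < k]) and in columns only if it is primed:
    this is the strip condition. *)
Lemma tab_shape T : is_tab k T -> exists nu : part,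
  [/\ nu \in subparts la, part_sub mu nu && strip (N < k)%N la nu &
     forall nu', nu' \in subparts la ->
       part_sub mu nu' && strip (N < k)%N la nu' -> fits T nu' = (nu' == nu)].
Proof.
move=> /is_tabP tT; have /part_subP hm := sub_mu.
have rows c d : crow c = crow d -> (ccol c <= ccol d)%N -> (T c <= T d)%N.
  move=> e; rewrite leq_eqVlt => /orP[/eqP|lt_cd].
    by move=> /(cell_eq e) ->.
  by have [/(_ e lt_cd) h _] := tT c d; lia.
have cols c d : ccol c = ccol d -> (crow c <= crow d)%N -> (T c <= T d)%N.
  move=> e; rewrite leq_eqVlt => /orP[/eqP e'|lt_cd].
    by rewrite (cell_eq e' e).
  by have [_ /(_ e lt_cd) h] := tT c d; lia.
pose f r := bnd T r N.
(* The argument of [bnd_spec], which covers unprimed alphabets only; weak increase along rows is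
   enough for it. *)
have fT c : (T c < N)%N = (ccol c < f (crow c))%N.
  apply/idP/idP => [|lt_c]; first exact: bnd_gt.
  have [e|[d [e1 e2 e3]]] := bndP T (crow c) N.
    by have := cell_ge c; move: lt_c; rewrite /f; lia.
  apply: leq_ltn_trans e2; apply: rows => //.
  by move: lt_c; rewrite /f e3.
have f_dec r : (f r.+1 <= f r)%N.
  rewrite /f; have [->|[d [e1 e2 ->]]] := bndP T r.+1 N.
    by apply: leq_trans (bnd_ge _ _ _); apply: part_anti.
  have [lt_m|ge_m] := ltnP (ccol d) (nth 0%N mu r).
    exact: leq_trans (bnd_ge _ _ _).
  have lt_l : (ccol d < nth 0%N la r)%N.
    by apply: leq_trans (cell_lt d) _; rewrite e1; apply: part_anti.
  have [c [f1 f2]] := cellP ge_m lt_l.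
  rewrite -f2 -f1; apply: bnd_gt; apply: leq_ltn_trans e2.
  by apply: cols; rewrite ?f2 // f1 e1.
have f0 : f (size la) = 0%N.
  apply/eqP; rewrite -leqn0; apply: leq_trans (bnd_le hm _ _ _) _.
  by rewrite nth_default.
have nthf := nth_part_of_fun f_dec f0.
have sub_nu : part_sub (part_of_fun f (size la)) la.
  by apply/part_subP => r; rewrite nthf; apply: bnd_le.
exists (part_of_fun f (size la)); split.
- by rewrite mem_subparts.
- apply/andP; split; first by apply/part_subP => r; rewrite nthf; apply: bnd_ge.
  apply/stripP; split=> r; first exact: (part_subP _ _ sub_nu).
  (* A violation of the strip condition produces two cells with letter [N], in one column if [N] is
     unprimed and in one row if it is primed. *)
  rewrite nthf; case: ltnP => [lt_Nk|le_kN]; rewrite leqNgt; apply/negP => lt_f.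
    have [d [e1 e2]] := cellP (leq_trans (part_anti mu (leqnSn r)) (bnd_ge T r N)) lt_f.
    have [c [f1 f2]] := cellP (bnd_ge T r N) (leq_trans lt_f (part_anti la (leqnSn r))).
    have hc := fT c; have hd := fT d; move: hc hd; rewrite f1 f2 e1 e2 ltnn.
    have := f_dec r; rewrite /f in lt_f *.
    have [_] := tT c d; rewrite e1 e2 f1 f2 ltnSn => /(_ erefl isT).
    by have := ltn_ord (T c); have := ltn_ord (T d); lia.
  have [c [f1 f2]] := cellP (bnd_ge T r N) (ltnW lt_f).
  have [d [e1 e2]] := cellP (leqW (bnd_ge T r N)) lt_f.
  have hc := fT c; have hd := fT d; move: hc hd; rewrite f1 f2 e1 e2 ltnn.
  have [h _] := tT c d; move: h; rewrite e1 e2 f1 f2 ltnSn => /(_ erefl isT).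
  by have := ltn_ord (T c); have := ltn_ord (T d); rewrite /f; lia.
- move=> nu' _ /andP[/part_subP s1 /stripP[s2 _]]; apply/forallP/eqP => [fit|-> c].
    apply: part_ext => r; rewrite nthf.
    have h1 := bnd_ge T r N; have h2 : (f r <= _)%N := bnd_le hm T r N.
    apply/eqP; rewrite eqn_leq; apply/andP; split; rewrite leqNgt; apply/negP => lt_b.
      have [c [e1 e2]] := cellP h1 (leq_trans lt_b (s2 r)).
      by have /eqP := fit c; rewrite fT e1 e2; move: lt_b; rewrite /f; lia.
    have [c [e1 e2]] := cellP (s1 r) (leq_trans lt_b h2).
    by have /eqP := fit c; rewrite fT e1 e2; move: lt_b; rewrite /f; lia.
  by rewrite nthf fT.
Qed.

(** Restriction to [nu] is a bijection onto the tableaux of shape nu/mu. Its inverse [ext] writes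
    [N] in every other cell, which is legal because these cells form a strip. *)
Lemma tab_fits (A : comNzRingType) (x : nat -> A) nu :
    part_sub mu nu -> strip (N < k)%N la nu ->
  \sum_(T : {ffun cell la mu -> 'I_N.+1} | is_tab k T && fits T nu)
     \prod_c x (T c) =
  x N ^+ (sumn la - sumn nu) * tabsum N k nu mu x.
Proof.
move=> sub_nu /[dup] /strip_sub sub_la /stripP[/= s1 s2].
have /part_subP hm := sub_mu; have /part_subP hmn := sub_nu.
have inj_ex (c : cell nu mu) : exists d : cell la mu,
    crow d = crow c /\ ccol d = ccol c.
  by apply: cellP; rewrite ?cell_ge //; apply: leq_trans (cell_lt c) (s1 _).
have ex_up (c : cell nu mu) : exists d : cell la mu,
    (crow d == crow c) && (ccol d == ccol c).
  by have [d [e1 e2]] := inj_ex c; exists d; rewrite e1 e2 !eqxx.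
pose up (c : cell nu mu) := xchoose (ex_up c).
have up_row (c : cell nu mu) : crow (up c) = crow c.
  by have /andP[/eqP] := xchooseP (ex_up c).
have up_col (c : cell nu mu) : ccol (up c) = ccol c.
  by have /andP[_ /eqP] := xchooseP (ex_up c).
have up_inj : injective up.
  by move=> c d e; apply: cell_eq; rewrite -?up_row -?up_col e.
pose inn (d : cell la mu) := (ccol d < nth 0 nu (crow d))%N.
have up_in (c : cell nu mu) : inn (up c) by rewrite /inn up_row up_col cell_lt.
have in_up d : inn d -> exists c, d = up c.
  move=> /(cellP (cell_ge d)) [c [e1 e2]]; exists c.
  by apply: cell_eq; rewrite ?up_row ?up_col.
pose dn d := [pick c | up c == d].
have upK c : dn (up c) = Some c.
  by rewrite /dn; case: pickP => [c' /eqP/up_inj ->//|/(_ c)]; rewrite eqxx.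
have dn_out d : ~~ inn d -> dn d = None.
  by rewrite /dn; case: pickP => // c /eqP <-; rewrite up_in.
pose ext (U : {ffun cell nu mu -> 'I_N}) : {ffun cell la mu -> 'I_N.+1} :=
  [ffun d => if dn d is Some c then widen_ord (leqnSn N) (U c) else ord_max].
have ext_up U c : ext U (up c) = U c :> nat by rewrite ffunE upK.
have ext_out U d : ~~ inn d -> ext U d = N :> nat by move=> h; rewrite ffunE dn_out.
have ext_inj : injective ext.
  move=> U V e; apply/ffunP => c; apply/val_inj.
  by rewrite /= -!ext_up e.
have ext_fits U : fits (ext U) nu.
  apply/forallP => d; rewrite -/(inn d); have [hd|hd] := boolP (inn d).
    by have [c ->] := in_up d hd; rewrite ext_up ltn_ord.
  by rewrite ext_out // ltnn.
have ext_tab U : is_tab k (ext U) = is_tab k U.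
  apply/is_tabP/is_tabP => tU c d.
    by have := tU (up c) (up d); rewrite !up_row !up_col !ext_up.
  have [hc|hc] := boolP (inn c); have [hd|hd] := boolP (inn d).
  - have [c' ->] := in_up c hc; have [d' ->] := in_up d hd.
    by rewrite !up_row !up_col !ext_up.
  - have [c' ->] := in_up c hc; rewrite ext_up (ext_out _ _ hd).
    by split=> _ _; left; apply: ltn_ord.
  (* Impossible case: a cell inside [nu] is neither to the right of nor below a cell outside it. *)
  - split=> e l; case/negP: hc; rewrite /inn.
      by rewrite e; apply: ltn_trans l _.
    by rewrite e; apply: leq_trans hd _; apply: part_anti; apply: ltnW.
  rewrite !ext_out //; split=> e l; right; split=> //.
    move: (s2 (crow c)); case: ltnP => // _.
    by have := cell_lt d; rewrite -e; move: hc hd; rewrite /inn -?e; idtac; lia.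
  move: (s2 (crow c)); case: ltnP => // _.
  have := cell_lt d; have := part_anti la l; have := part_anti nu l.
  by move: hc hd; rewrite /inn -?e; lia.
rewrite /tabsum mulr_sumr.
rewrite (eq_bigl (fun T => (T \in [set ext U | U : {ffun cell nu mu -> 'I_N}])
    && is_tab k T)); last first.
  move=> T; rewrite andbC; congr (_ && _); apply/idP/imsetP => [/forallP fT|[U _ ->]//].
  have lt_N c : (T (up c) < N)%N by rewrite (eqP (fT _)) up_row up_col cell_lt.
  exists [ffun c => Ordinal (lt_N c)] => //; apply/ffunP => d; apply/val_inj.
  have [/in_up[c ->]|hd] := boolP (inn d); first by rewrite /= ext_up ffunE.
  rewrite /= ext_out //; have := eqP (fT d); rewrite -/(inn d) (negPf hd).
  by move=> /negbT; rewrite -leqNgt => h; apply/eqP; rewrite eqn_leq h -ltnS ltn_ord.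
rewrite big_imset_cond /=; last by move=> ? ? _ _ /ext_inj.
apply: eq_big => [U|U _]; first exact: ext_tab.
rewrite (bigID inn) /= mulrC; congr (_ * _).
  rewrite (eq_bigr (fun _ => x N)) => [|d hd]; last by rewrite ext_out.
  rewrite prodr_const; congr (_ ^+ _).
  have e1 : #|[pred d | inn d]| = #|{: cell nu mu}|.
    rewrite -(card_imset _ up_inj); apply: eq_card => d; rewrite inE.
    by apply/idP/imsetP => [/in_up[c ->]|[c _ ->]//]; exists c.
  have e2 := cardC [pred d | inn d]; rewrite e1 !card_cell // in e2.
  transitivity #|[predC [pred d | inn d]]|; first exact: eq_card.
  have := part_sub_sumn sub_nu; have := part_sub_sumn sub_la.
  by move: e2; move: #|_| (sumn nu) (sumn la) (sumn mu); clear => a b c d; lia.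
rewrite (eq_bigl (fun d => d \in [set up c | c : cell nu mu])); last first.
  by move=> d; apply/idP/imsetP => [/in_up[c ->]|[c _ ->]//]; exists c.
rewrite big_imset /=; last by move=> ? ? _ _ /up_inj.
by apply: eq_bigr => c _; rewrite ext_up.
Qed.

(** This recursion in the number of letters yields the cutting of tableaux, the recurrences for rows
    and hooks, and the expansion in an extra variable. *)
Lemma tabsum_branch (A : comNzRingType) (x : nat -> A) :
  tabsum N.+1 k la mu x =
  \sum_(nu <- subparts la | part_sub mu nu && strip (N < k)%N la nu)
     x N ^+ (sumn la - sumn nu) * tabsum N k nu mu x.
Proof.
rewrite /tabsum (partition_big_seq (r := fits) _ (subparts_uniq la) tab_shape).
apply: eq_bigr => nu /andP[h1 h2]; exact: tab_fits.
Qed.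

End Branching.

(** * Conjugation and cutting *)

(** In a weakly decreasing list the entries above [i] form an initial segment. *)
Lemma ltn_count_part (la : part) i j :
  (j < count (fun p => i < p) la)%N = (i < nth 0 la j)%N.
Proof.
case: la => s /= /andP[ss _]; elim: s ss j => [|a s IHs] ss j; first by rewrite nth_nil.
have ss' := path_sorted ss; have le_a : all (fun b => b <= a)%N s.
  by apply: order_path_min ss => x y z h1 h2; apply: leq_trans h2 h1.
rewrite /=; case: (ltnP i a) => [lt_ia|le_ai].
  by case: j => [|j] //=; rewrite add1n ltnS IHs.
have -> : count (fun p => i < p)%N s = 0%N.
  apply/eqP; rewrite -leqn0 leqNgt -has_count; apply/hasPn => b bs.
  by rewrite -leqNgt (leq_trans _ le_ai) // (allP le_a).
rewrite addn0 ltn0; apply/esym/negbTE; rewrite -leqNgt.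
case: j => [|j] //=; have [lt_j|le_j] := ltnP j (size s).
  by rewrite (leq_trans _ le_ai) // (allP le_a) ?mem_nth.
by rewrite nth_default.
Qed.

Lemma ltn_conj_part (la : part) i j :
  (j < nth 0 (conj_part la) i)%N = (i < nth 0 la j)%N.
Proof.
have [lt_i|le_i] := ltnP i (head 0%N la).
  by rewrite (nth_map 0%N) ?size_iota // nth_iota // ltn_count_part.
rewrite [nth 0%N (conj_part la) i]nth_default ?size_map ?size_iota //.
by apply/esym/negbTE; rewrite -leqNgt (leq_trans (part_head la j)).
Qed.

Lemma conj_part_sub (la mu : part) :
  part_sub mu la -> part_sub (conj_part mu) (conj_part la).
Proof.
move=> /part_subP h; apply/part_subP => i; rewrite leqNgt; apply/negP.
by rewrite ltn_conj_part => h1; have := leq_trans h1 (h _); rewrite -ltn_conj_part ltnn.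
Qed.

(** Transposing a tableau exchanges the row and column conditions, so an alphabet of primed letters
    only ([k = 0]) becomes one of unprimed letters only. *)
Lemma conj_tabsum (A : comNzRingType) N (la mu : part) (x : nat -> A) :
  tabsum N 0 la mu x = tabsum N N (conj_part la) (conj_part mu) x.
Proof.
have ex_tr (c : cell la mu) : exists d : cell (conj_part la) (conj_part mu),
    (crow d == ccol c) && (ccol d == crow c).
  have [||d [e1 e2]] := @cellP (conj_part la) (conj_part mu) (ccol c) (crow c).
  - by rewrite leqNgt ltn_conj_part -leqNgt cell_ge.
  - by rewrite ltn_conj_part cell_lt.
  by exists d; rewrite e1 e2 !eqxx.
have ex_rt (d : cell (conj_part la) (conj_part mu)) : exists c : cell la mu,
    (crow c == ccol d) && (ccol c == crow d).
  have [||c [e1 e2]] := @cellP la mu (ccol d) (crow d).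
  - by rewrite leqNgt -ltn_conj_part -leqNgt cell_ge.
  - by rewrite -ltn_conj_part cell_lt.
  by exists c; rewrite e1 e2 !eqxx.
pose tr c := xchoose (ex_tr c); pose rt d := xchoose (ex_rt d).
have tr_row c : crow (tr c) = ccol c by have /andP[/eqP] := xchooseP (ex_tr c).
have tr_col c : ccol (tr c) = crow c by have /andP[_ /eqP] := xchooseP (ex_tr c).
have rt_row d : crow (rt d) = ccol d by have /andP[/eqP] := xchooseP (ex_rt d).
have rt_col d : ccol (rt d) = crow d by have /andP[_ /eqP] := xchooseP (ex_rt d).
have trK : cancel tr rt by move=> c; apply: cell_eq; rewrite ?rt_row ?rt_col.
have rtK : cancel rt tr by move=> c; apply: cell_eq; rewrite ?tr_row ?tr_col.
rewrite /tabsum (reindex_onto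
  (fun U : {ffun cell (conj_part la) (conj_part mu) -> 'I_N} =>
    [ffun c => U (tr c)] : {ffun cell la mu -> 'I_N})
  (fun T => [ffun d => T (rt d)])) /=; last first.
  by move=> T _; apply/ffunP => c; rewrite !ffunE trK.
apply: eq_big => [U|U _].
  have -> : [ffun d => [ffun c => U (tr c)] (rt d)] == U.
    by apply/eqP/ffunP => d; rewrite !ffunE rtK.
  rewrite andbT; apply/is_tabP/is_tabP => tU c d.
    have [h1 h2] := tU (rt c) (rt d).
    move: h1 h2; rewrite !rt_row !rt_col !ffunE !rtK ltn_ord => h1 h2.
    split=> e l; first by case: (h2 e l) => [|[h _]]; [left|right].
    by case: (h1 e l) => [|[_]] //; left.
  have [h1 h2] := tU (tr c) (tr d).
  move: h1 h2; rewrite !tr_row !tr_col !ffunE => h1 h2.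
  split=> e l; last by case: (h1 e l) => [|[h _]]; [left|right].
  by case: (h2 e l) => [|[_]] //; [left|rewrite leqNgt ltn_ord].
rewrite (reindex tr) /=; last by exists rt => c _; [exact: trK | exact: rtK].
by apply: eq_bigr => c _; rewrite ffunE.
Qed.

(** Puts the nested sums over chains of partitions on the common list [subparts la], so that they
    can be exchanged. *)
Lemma big_subparts (R : nmodType) (la nu : part) (P : pred part) (F : part -> R) :
  part_sub nu la ->
  \sum_(rho <- subparts nu | P rho) F rho =
  \sum_(rho <- subparts la | part_sub rho nu && P rho) F rho.
Proof.
move=> sub_nu; rewrite -big_filter_cond; apply: perm_big; apply: uniq_perm.
- exact: subparts_uniq.
- exact/filter_uniq/subparts_uniq.
move=> rho; rewrite mem_filter !mem_subparts.
by apply/idP/andP => [h|[]//]; split=> //; apply: part_sub_trans sub_nu.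
Qed.

Lemma tabsum_refl (A : comNzRingType) N k (la : part) (x : nat -> A) :
  tabsum N k la la x = 1.
Proof.
have nc (c : cell la la) : False.
  by have := leq_ltn_trans (cell_ge c) (cell_lt c); rewrite ltnn.
pose T : {ffun cell la la -> 'I_N} := [ffun c => False_rect _ (nc c)].
rewrite /tabsum (big_pred1 T) => [|U]; first by rewrite big1 // => c; have := nc c.
have -> : U = T by apply/ffunP => c; have := nc c.
by rewrite [RHS]eqxx; apply/is_tabP => c; have := nc c.
Qed.

Lemma tabsum0 (A : comNzRingType) k (la mu : part) (x : nat -> A) :
  part_sub mu la -> tabsum 0 k la mu x = (mu == la)%:R.
Proof.
move=> /part_subP sub_mu; case: eqP => [->|ne]; first exact: tabsum_refl.
rewrite /tabsum big1 // => T _; case: ne; apply: part_ext => r.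
apply/eqP; rewrite eqn_leq sub_mu leqNgt /=.
by apply/negP => /(cellP (leqnn _)) [c _]; have := ltn_ord (T c).
Qed.

(** The primed letters are removed one by one with [tabsum_branch], on both sides; no bijection
    between fillings is set up. *)
Lemma tabsum_split (A : comNzRingType) k l (la mu : part) (x : nat -> A) :
  part_sub mu la ->
  tabsum (k + l) k la mu x =
  \sum_(nu <- subparts la | part_sub mu nu)
     tabsum k k nu mu x * tabsum l 0 la nu (fun i => x (k + i)%N).
Proof.
elim: l la => [|l IHl] la sub_mu.
  rewrite addn0 big_seq_cond.
  rewrite (eq_bigr (fun nu => if nu == la then tabsum k k nu mu x else 0)).
    rewrite -big_seq_cond (big_rem la) ?mem_subparts ?part_sub_refl //= sub_mu eqxx.
    rewrite big_seq_cond big1 ?addr0 // => nu.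
    by rewrite mem_rem_uniq ?subparts_uniq // inE => /andP[/andP[/negPf/= -> _] _].
  move=> nu /andP[]; rewrite mem_subparts => h _; rewrite tabsum0 //.
  by case: eqP => _; rewrite ?mulr1 ?mulr0.
rewrite addnS tabsum_branch // ltnNge leq_addr /=.
have e nu : part_sub mu nu && strip false la nu ->
    x (k + l)%N ^+ (sumn la - sumn nu) * tabsum (k + l) k nu mu x =
    \sum_(rho <- subparts la | part_sub rho nu && part_sub mu rho)
       tabsum k k rho mu x *
        (x (k + l)%N ^+ (sumn la - sumn nu) * tabsum l 0 nu rho (fun i => x (k + i)%N)).
  move=> /andP[h1 /strip_sub h2]; rewrite IHl // (big_subparts _ _ h2) mulr_sumr.
  by apply: eq_bigr => rho _; rewrite mulrCA.
rewrite (eq_bigr _ e) (exchange_big_dep (part_sub mu)) /=; last first.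
  by move=> nu rho _ /andP[].
rewrite big_seq_cond [RHS]big_seq_cond; apply: eq_bigr => rho /andP[].
rewrite mem_subparts => h1 h2; rewrite tabsum_branch // -mulr_sumr.
congr (_ * _); apply: eq_bigl => nu; rewrite h2 andbT ltn0 [RHS]andbC.
case h3: (part_sub rho nu); rewrite ?andbF // !andbT.
by rewrite (part_sub_trans h2 h3).
Qed.

Lemma rmorph_tabsum (A B : comNzRingType) (f : {rmorphism A -> B}) N k la mu
    (x : nat -> A) :
  f (tabsum N k la mu x) = tabsum N k la mu (f \o x).
Proof. by rewrite rmorph_sum; apply: eq_bigr => T _; rewrite rmorph_prod. Qed.

Definition xvar N (i : nat) : {mpoly rat[N]} :=
  if insub i is Some j then 'X_j else 0.

Lemma xvarE N (i : 'I_N) : xvar N i = 'X_i.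
Proof. by rewrite /xvar valK. Qed.

Lemma tab_polyE N k la mu : tab_poly N k la mu = tabsum N k la mu (xvar N).
Proof. by apply: eq_bigr => T _; apply: eq_bigr => c _; rewrite xvarE. Qed.

Lemma schurE (la : part) n : schur la n = tabsum n n la empty_part (xvar n).
Proof. by rewrite -tab_polyE. Qed.

Lemma skew_schurE (la mu : part) n : part_sub mu la ->
  skew_schur la mu n = tabsum n n la mu (xvar n).
Proof. by move=> h; rewrite -tab_polyE /= /skew_poly h. Qed.

Lemma symfun_sumE (I : Type) (s : seq I) (P : pred I) (F : I -> symfun) n :
  (\sum_(i <- s | P i) F i) n = \sum_(i <- s | P i) F i n.
Proof. by elim/big_rec2: _ => // i f g _ <-. Qed.

Lemma DS_diag (la : part) n : DS la n = diag (HS n n la).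
Proof.
rewrite /diag /HS tab_polyE rmorph_tabsum.
rewrite (@eq_tabsum _ _ _ _ _ _
  (fun i => if (i < n)%N then xvar n i else xvar n (i - n)%N)).
  rewrite tabsum_split ?part_sub0 // /DS symfun_sumE big_seq [RHS]big_seq.
  apply: eq_big => [//|nu].
  rewrite mem_subparts => h.
  rewrite -[LHS]/(schur nu n * skew_schur (conj_part la) (conj_part nu) n).
  rewrite (skew_schurE _ (conj_part_sub h)) conj_tabsum.
  rewrite schurE.
  congr (_ * _); apply: eq_tabsum => i lt_i; first by rewrite lt_i.
  by rewrite ltnNge leq_addr addKn.
move=> i lt_i; rewrite /= -[i]/(val (Ordinal lt_i)) xvarE comp_mpolyXU.
rewrite -tnth_nth tnth_mktuple.
by case: splitP => j /= ->; rewrite ?addKn xvarE.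
Qed.

(** * Schur functions span *)

(** A list of terms with possible repetitions makes closure under addition a mere concatenation; [P]
    keeps track of the sizes of the partitions involved. *)
Definition in_span (V : lmodType rat) (B : part -> V) (P : pred part) (f : V) :=
  exists2 s : seq (rat * part), all (fun t => P t.2) s &
    f = \sum_(t <- s) t.1 *: B t.2.

Lemma in_span0 V B P : @in_span V B P 0.
Proof. by exists [::]; rewrite ?big_nil. Qed.

Lemma in_span_base V B (P : pred part) la : P la -> @in_span V B P (B la).
Proof. by move=> h; exists [:: (1, la)]; rewrite /= ?h // big_seq1 scale1r. Qed.

Lemma in_spanD V B P f g : @in_span V B P f -> in_span B P g -> in_span B P (f + g).
Proof.
by move=> [s Ps ->] [t Pt ->]; exists (s ++ t); rewrite ?all_cat ?Ps // big_cat.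
Qed.

Lemma in_spanZ V B P a f : @in_span V B P f -> in_span B P (a *: f).
Proof.
move=> [s Ps ->]; exists [seq (a * t.1, t.2) | t <- s]; first by rewrite all_map.
by rewrite big_map scaler_sumr; apply: eq_bigr => t _; rewrite scalerA.
Qed.

Lemma in_span_sum V B P (I : Type) (s : seq I) (Q : pred I) F :
  (forall i, Q i -> @in_span V B P (F i)) -> in_span B P (\sum_(i <- s | Q i) F i).
Proof. by move=> h; elim/big_ind: _ => //; [exact: in_span0 | apply: in_spanD]. Qed.

(** [msize] is one more than the degree, and 0 for the zero polynomial. *)
Definition deg_le d (f : symfun) := forall n, (msize (f n) <= d.+1)%N.

Lemma symfun_deg (f : symfun) : exists d, deg_le d f.
Proof. by have [_ _ [d h]] := symfunP f; exists d => n; apply: leqW. Qed.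

Lemma deg_le_sub d f g : deg_le d f -> deg_le d g -> deg_le d (f - g).
Proof.
move=> h1 h2 n /=; apply: leq_trans (msizeD_le _ _) _.
by rewrite geq_max h1 msizeN h2.
Qed.

Lemma deg_leZ d a f : deg_le d f -> deg_le d (a *: f).
Proof. by move=> h n; apply: leq_trans (msizeZ_le _ _) (h n). Qed.

Lemma homog_deg_le d f : homogeneous d f -> deg_le d f.
Proof.
move=> h n; rewrite msizeE; apply/bigmax_leqP_seq => m m_f _.
by rewrite ltnS (dhomog_mf (h n) m_f).
Qed.

Lemma kill_lastX n (k : 'X_{1..n.+1}) :
  kill_last 'X_[k] = if k ord_max == 0%N
    then 'X_[[multinom k (lift ord_max i) | i < n]] else 0.
Proof.
rewrite /kill_last comp_mpolyX big_ord_recr /= tnth_mktuple unlift_none expr0n.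
case: eqP => _; rewrite ?mulr0 // mulr1 mpolyXE_id.
apply: eq_bigr => i _.
have -> : widen_ord (leqnSn n) i = lift ord_max i.
  by apply/val_inj; rewrite /= /bump leqNgt ltn_ord.
by rewrite tnth_mktuple liftK mnmE.
Qed.

Lemma mcoeff_kill_last n (p : {mpoly rat[n.+1]}) m :
  (kill_last p)@_m = p@_(mnmwiden m).
Proof.
elim/mpolyind: p => [|c k p _ _ IHp]; first by rewrite /kill_last raddf0 !mcoeff0.
rewrite /kill_last comp_mpolyD comp_mpolyZ -!/(kill_last _) !mcoeffD IHp; congr (_ + _).
rewrite !mcoeffZ; congr (_ * _).
rewrite kill_lastX mcoeffX.
have wE i : mnmwiden m (lift ord_max i) = m i.
  have -> : lift ord_max i = widen_ord (leqnSn n) i.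
    by apply/val_inj; rewrite /= /bump leqNgt ltn_ord.
  exact: mnmwiden_widen.
case: eqP => [k0|k0]; last first.
  by rewrite mcoeff0; case: eqP k0 => // ->; rewrite mnmwiden_ordmax.
rewrite mcoeffX; congr (nat_of_bool _)%:R; apply/eqP/eqP => /mnmP e.
  apply/mnmP => i; case: (unliftP ord_max i) => [j|] ->; last by rewrite k0 mnmwiden_ordmax.
  by rewrite wE -e mnmE.
by apply/mnmP => i; rewrite mnmE e wE.
Qed.

(** A monomial of degree at most n in n + 1 variables omits one of them. By symmetry this may be
    taken to be the last one, and then [kill_last] preserves the coefficient. *)
Lemma kill_last_inj n (p : {mpoly rat[n.+1]}) :
  p \is symmetric -> (msize p <= n.+1)%N -> kill_last p = 0 -> p = 0.
Proof.
move=> sym_p sz_p p0; apply/mpolyP => m; rewrite mcoeff0; apply/eqP.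
rewrite mcoeff_eq0; apply/negP => m_p.
have lt_m : (mdeg m < n.+1)%N by apply: leq_trans sz_p; apply: msize_mdeg_lt.
have [i /eqP mi|nz] := pickP (fun i => m i == 0%N); last first.
  move: lt_m; rewrite ltnNge mdegE => /negP[].
  rewrite -[X in (X <= _)%N](card_ord n.+1) -sum1_card; apply: leq_sum => i _.
  by rewrite lt0n nz.
have := mcoeff_sym p (tperm i ord_max) m.
set m' := [multinom _ | _ < _]; rewrite (issymP _ sym_p).
have m'0 : m' ord_max = 0%N by rewrite mnmE tpermR.
have -> : m' = mnmwiden [multinom m' (lift ord_max i) | i < n].
  apply/mnmP => j; case: (unliftP ord_max j) => [l|] ->; last by rewrite m'0 mnmwiden_ordmax.
  have {1 2}-> : lift ord_max l = widen_ord (leqnSn n) l.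
    by apply/val_inj; rewrite /= /bump leqNgt ltn_ord.
  rewrite mnmwiden_widen mnmE; congr (m' _).
  by apply/val_inj; rewrite /= /bump leqNgt ltn_ord.
by rewrite -mcoeff_kill_last p0 mcoeff0 => /eqP; rewrite mcoeff_eq0 m_p.
Qed.

(** Stability under [kill_last] goes down from [d] variables, and [kill_last_inj] goes up. *)
Lemma symfun_eq0 d (f : symfun) : deg_le d f -> f d = 0 -> f = 0.
Proof.
move=> df f0; have [sym_f kill_f _] := symfunP f.
apply: symfun_eq => n; rewrite -[RHS]/(0 : {mpoly rat[n]}).
have [le_nd|/ltnW le_dn] := leqP n d.
  have: f (n + (d - n))%N = 0 by rewrite subnKC.
  elim: (d - n)%N => [|k IHk]; rewrite ?addn0 // addnS => h; apply: IHk.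
  by rewrite -kill_f h /kill_last raddf0.
rewrite -(subnKC le_dn); elim: (n - d)%N => [|k IHk]; rewrite ?addn0 // addnS.
apply: kill_last_inj; rewrite ?kill_f //.
by apply: leq_trans (df _) _; rewrite ltnS leq_addr.
Qed.

Lemma deg_le_eq d (f g : symfun) : deg_le d f -> deg_le d g -> f d = g d -> f = g.
Proof.
move=> df dg e; apply/eqP; rewrite -subr_eq0; apply/eqP.
by apply: (symfun_eq0 (deg_le_sub df dg)); rewrite /= e subrr.
Qed.

Definition wt N la mu (T : {ffun cell la mu -> 'I_N}) : 'X_{1..N} :=
  (\sum_c U_(T c))%MM.

Lemma wtE N la mu (T : {ffun cell la mu -> 'I_N}) i :
  wt T i = #|[set c | T c == i]|.
Proof.
rewrite /wt mnm_sumE -sum1_card [RHS]big_mkcond /=.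
by apply: eq_bigr => c _; rewrite mnmE inE; case: eqP.
Qed.

Lemma mdeg_wt N la mu (T : {ffun cell la mu -> 'I_N}) : mdeg (wt T) = #|{: cell la mu}|.
Proof. by rewrite /wt mdeg_sum -sum1_card; apply: eq_bigr => c _; rewrite mdeg1. Qed.

Lemma tab_poly_wt N k la mu : tab_poly N k la mu =
  \sum_(T : {ffun cell la mu -> 'I_N} | is_tab k T) 'X_[wt T].
Proof. by apply: eq_bigr => T _; rewrite mprodXE. Qed.

Lemma schur_homog (la : part) : homogeneous (sumn la) (schur la).
Proof.
move=> n /=; rewrite /skew_poly part_sub0 tab_poly_wt; apply: rpred_sum => T _.
by rewrite dhomogX -[X in X == _]/(mdeg (wt T)) mdeg_wt card_cell // subn0.
Qed.

Lemma card_row (la : part) r :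
  #|[set c : cell la empty_part | crow c == r]| = nth 0%N la r.
Proof.
have ex (x : 'I_(nth 0%N la r)) :
    exists c : cell la empty_part, (crow c == r) && (ccol c == x).
  have [|c [e1 e2]] := @cellP la empty_part r x _ (ltn_ord x); first by rewrite nth_nil.
  by exists c; rewrite e1 e2 !eqxx.
pose g x := xchoose (ex x).
have g_row x : crow (g x) = r by have /andP[/eqP] := xchooseP (ex x).
have g_col x : ccol (g x) = x by have /andP[_ /eqP] := xchooseP (ex x).
rewrite -[RHS]card_ord -(card_imset (f := g)) => [|x y e]; last first.
  by apply/val_inj; rewrite /= -(g_col x) -(g_col y) e.
apply: eq_card => c; rewrite inE; apply/eqP/imsetP => [e|[x _ ->]//].
have lt_c : (ccol c < nth 0%N la r)%N by rewrite -e cell_lt.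
by exists (Ordinal lt_c) => //; apply: cell_eq; rewrite ?g_row ?g_col.
Qed.

Lemma tab_ge_row n (la : part) (T : {ffun cell la empty_part -> 'I_n}) c :
  is_tab n T -> (crow c <= T c)%N.
Proof.
move=> /ssytP tT; move e : (crow c) => r; elim: r c e => // r IHr c e.
have [||d [e1 e2]] := @cellP la empty_part r (ccol c); first by rewrite nth_nil.
  by apply: leq_trans (cell_lt c) _; rewrite e; apply: part_anti.
by apply: leq_ltn_trans (IHr d e1) _; apply: (tT d c).2; rewrite // e e1.
Qed.

Definition part_mnm n (la : part) : 'X_{1..n} := [multinom nth 0%N la i | i < n].

(** Triangularity of Schur polynomials: entries are at least their row index, and the tableau [T0]
    with equality everywhere has the largest weight, attained only once. *)
Lemma mcoeff_schur_lead n (la : part) k : (size la <= n)%N ->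
  (part_mnm n la <= k)%O -> (schur la n)@_k = (k == part_mnm n la)%:R.
Proof.
move=> le_n le_k; rewrite -[symfun_val _ _]/(skew_poly la empty_part n).
rewrite /skew_poly part_sub0 tab_poly_wt raddf_sum.
have lt_row (c : cell la empty_part) : (crow c < n)%N.
  by apply: leq_trans le_n; apply: ltn_ord.
pose T0 : {ffun cell la empty_part -> 'I_n} := [ffun c => Ordinal (lt_row c)].
have T0E c : T0 c = crow c :> nat by rewrite ffunE.
have wt0 : wt T0 = part_mnm n la.
  apply/mnmP => i; rewrite wtE mnmE -card_row.
  by apply: eq_card => c; rewrite !inE -val_eqE /= T0E.
have tab0 : is_tab n T0.
  by apply/ssytP => c d; rewrite !T0E; split=> // ->.
transitivity ('X_[rat, wt T0]@_k + \sum_(T | is_tab n T && (T != T0)) 'X_[rat, wt T]@_k).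
  exact: bigD1.
rewrite mcoeffX wt0 eq_sym big1 ?addr0 // => T /andP[tT neT].
rewrite [LHS]mcoeffX; suff lt_T : (wt T < part_mnm n la)%O.
  by case: eqP => // e; move: (lt_le_trans lt_T le_k); rewrite e ltxx.
have ge_T c := tab_ge_row c tT.
have [c0 hc0] : exists c, T c != crow c :> nat.
  apply/existsP; apply: contraNT neT; rewrite negb_exists => /forallP h.
  apply/eqP/ffunP => c; apply/val_inj; rewrite /= T0E; apply/eqP.
  by move: (h c); rewrite negbK.
(* A cell in the topmost row containing a wrong letter: the weights of [T] and [T0] agree on the
   smaller letters, and [T] uses the letter of that row less often. *)
pose r0 := [arg min_(c < c0 | (T c != crow c :> nat)) crow c].
have [c1 hc1 min_c1] : exists2 c, T c != crow c :> nat &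
    forall d, T d != crow d :> nat -> (crow c <= crow d)%N.
  by exists r0; rewrite /r0; case: arg_minnP.
rewrite -wt0; apply/ltmcP; first by rewrite !mdeg_wt.
have eqT d : (crow d < crow c1)%N -> T d = crow d :> nat.
  by move=> lt_d; apply/eqP; apply: contraTT lt_d => /min_c1; rewrite -leqNgt.
exists (Ordinal (lt_row c1)) => [j lt_j|]; rewrite !wtE.
  apply: eq_card => d; rewrite !inE -!val_eqE /= T0E.
  apply/eqP/eqP => e; last by rewrite eqT // e.
  by rewrite -eqT // (leq_ltn_trans (ge_T d)) // e.
apply/proper_card/properP; split; last first.
  by exists c1; rewrite !inE -!val_eqE /= ?T0E // eq_sym.
apply/subsetP => d; rewrite !inE -!val_eqE /= T0E => /eqP e.
have := ge_T d; rewrite e leq_eqVlt => /orP[//|lt_d].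
by have := eqT d lt_d; rewrite e => e'; move: lt_d; rewrite -e' ltnn.
Qed.

(** Elimination of leading terms in [d] variables, by well-founded induction on the monomial order.
    The leading exponents of a symmetric polynomial decrease, hence form a partition of size at most
    [d], whose Schur function is subtracted. *)
Lemma schur_span d f : deg_le d f -> in_span schur (fun la => (sumn la <= d)%N) f.
Proof.
have [m] : exists m, mlead (f d) = m by exists (mlead (f d)).
move: f; elim/(ltmwf (n := d)): m => m IHm f em df.
have [f0|nz_f] := eqVneq (f d) 0; first by rewrite (symfun_eq0 df f0); apply: in_span0.
have [sym_f _ _] := symfunP f.
pose g i := if insub i is Some j then m (j : 'I_d) else 0%N.
have gE (i : 'I_d) : g i = m i by rewrite /g valK.
have g0 i : (d <= i)%N -> g i = 0%N by move=> h; rewrite /g insubF // ltnNge h.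
have g_dec r : (g r.+1 <= g r)%N.
  have [lt_r|/g0 -> //] := ltnP r.+1 d.
  rewrite (gE (Ordinal lt_r)) (gE (Ordinal (ltnW lt_r))) -em.
  exact: mlead_msym_sorted.
pose la := part_of_fun g d.
have laE := nth_part_of_fun g_dec (g0 d (leqnn d)).
have m_la : part_mnm d la = m by apply/mnmP => i; rewrite mnmE laE gE.
have sz_la : (size la <= d)%N.
  rewrite leqNgt; apply/negP => lt_d; have := Defs.part_gt0 lt_d.
  by rewrite laE g0.
have sum_la : sumn la = mdeg m.
  rewrite (sumn_part sz_la) mdegE; apply: eq_bigr => i _.
  by rewrite laE gE.
have le_d : (sumn la <= d)%N.
  by rewrite sum_la -ltnS -em mlead_deg.
pose h := f - (f d)@_m *: schur la.
have dh : deg_le d h.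
  apply: deg_le_sub => //; apply: deg_leZ => n.
  by apply: leq_trans (homog_deg_le (@schur_homog la) n) _; rewrite ltnS.
have hk k : (m <= k)%O -> (h d)@_k = 0.
  move=> le_k; rewrite /h /= mcoeffB mcoeffZ.
  rewrite -[skew_poly _ _ _]/(schur la d) mcoeff_schur_lead ?m_la //.
  case: (eqVneq k m) => [->|ne]; first by rewrite mulr1 subrr.
  by rewrite mulr0 subr0 mcoeff_gt_mlead // em lt_neqAle eq_sym ne.
have -> : f = h + (f d)@_m *: schur la by rewrite subrK.
apply: in_spanD; last exact/in_spanZ/in_span_base.
have [h0|nz_h] := eqVneq (h d) 0; first by rewrite (symfun_eq0 dh h0); apply: in_span0.
apply: (IHm (mlead (h d))) => //; rewrite ltNge; apply/negP => /hk /eqP.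
by rewrite mleadc_eq0 (negPf nz_h).
Qed.

(** * Cancellation of strips *)

Lemma part_sub_antisym (la mu : part) : part_sub mu la -> sumn mu = sumn la -> mu = la.
Proof.
move=> s e; have h := card_cell s; rewrite e subnn in h.
have /part_subP sub := s.
apply/part_ext => r; apply/eqP; rewrite eqn_leq sub leqNgt /=.
apply/negP => /(cellP (leqnn _)) [c _]; move/eqP: h; rewrite -leqn0 leqNgt => /negP[].
by apply/card_gt0P; exists c.
Qed.

(** Row [i] is the last one in which the two partitions differ, so the next row of [la] is bounded
    by the next row of [nu]. *)
Lemma strip_corner (la nu : part) : part_sub nu la -> nu != la ->
  exists i, (nth 0 la i.+1 <= nth 0 nu i)%N && (nth 0 nu i < nth 0 la i)%N.
Proof.
move=> s ne; have /part_subP sub := s.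
pose Q i := (nth 0 nu i < nth 0 la i)%N.
have bQ i : Q i -> (i <= size la)%N.
  move=> q; rewrite leqNgt; apply: contraTN q => /ltnW /(nth_default 0%N) e.
  by rewrite /Q e ltn0.
have exQ : exists i, Q i.
  have [r q|h] := pickP (fun r : 'I_(size la).+1 => Q r); first by exists r.
  case/eqP: ne; apply: part_ext => r; apply/eqP; rewrite eqn_leq sub leqNgt /=.
  apply/negP => q; have lt_r : (r < (size la).+1)%N by rewrite ltnS bQ.
  by have := h (Ordinal lt_r); rewrite /Q q.
have [i Qi max_i] := ex_maxnP exQ bQ; exists i; apply/andP; split=> //.
apply: leq_trans (part_anti nu (leqnSn i)); rewrite leqNgt; apply/negP => q.
by have := max_i i.+1 q; rewrite ltnn.
Qed.

(* The rows of a partition between nu and la can be chosen independently;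
   toggling the one of strip_corner changes the sign. *)
Lemma strip_cancel (la nu : part) :
  \sum_(mu <- subparts la | strip true la mu && strip false mu nu)
     (-1) ^+ (sumn la - sumn mu) = (nu == la)%:R :> int.
Proof.
have [->|ne] := eqVneq nu la.
  rewrite (big_rem la) ?mem_subparts ?part_sub_refl //=.
  have sh h : strip h la la.
    by apply/stripP; split=> // r; case: (h); rewrite ?leqnSn // part_anti.
  rewrite !sh subnn expr0 big_seq_cond big1 ?addr0 // => mu.
  rewrite mem_rem_uniq ?subparts_uniq // inE mem_subparts.
  move=> /andP[/andP[/= /eqP ne s1] /andP[_ /strip_sub s2]]; case: ne.
  apply: part_sub_antisym => //; apply/eqP; rewrite eqn_leq.
  by rewrite !part_sub_sumn.
have [s|ns] := boolP (part_sub nu la); last first.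
  rewrite big1 // => mu /andP[/strip_sub s1 /strip_sub s2].
  by case/negP: ns; apply: part_sub_trans s1.
have [i /andP[le_i lt_i]] := strip_corner s ne.
pose P mu := strip true la mu && strip false mu nu.
(* The vertical strip allows nu_i and nu_i + 1 in row [i]. Both also satisfy the horizontal
   condition, as la_(i+1) <= nu_i < la_i by the choice of [i]. *)
pose v (mu : part) r := if r == i then
    (if nth 0 mu i == nth 0 nu i then (nth 0 nu i).+1 else nth 0 nu i)%N
  else nth 0%N mu r.
pose tg mu := part_of_fun (v mu) (size la).
have v_bnd mu : P mu -> forall r,
    [/\ nth 0 nu r <= v mu r, v mu r <= (nth 0 nu r).+1,
       nth 0 la r.+1 <= v mu r & v mu r <= nth 0 la r]%N.
  move=> /andP[/stripP[h1 h2] /stripP[h3 h4]] r; rewrite /v.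
  have [->|ne_r] := eqVneq r i; last by split; rewrite ?h1 ?h2 ?h3 ?h4.
  by case: eqP => _; split=> //; lia.
have nth_tg mu : P mu -> forall r, nth 0%N (tg mu) r = v mu r.
  move=> Pmu; apply: nth_part_of_fun => [r|].
    have [_ _ _ h1] := v_bnd mu Pmu r.+1; have [_ _ h2 _] := v_bnd mu Pmu r.
    exact: leq_trans h1 h2.
  have [_ _ _] := v_bnd mu Pmu (size la).
  by rewrite [nth _ _ _]nth_default // leqn0 => /eqP.
have P_tg mu : P mu -> P (tg mu).
  move=> Pmu; apply/andP; split; apply/stripP; split=> r; rewrite nth_tg //;
  by have [] := v_bnd mu Pmu r.
have tgK mu : P mu -> tg (tg mu) = mu.
  move=> Pmu; apply: part_ext => r; rewrite nth_tg ?P_tg //.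
  rewrite {1}/v !nth_tg // /v eqxx; case: (eqVneq r i) => // ->.
  have /andP[_ /stripP[h3 h4]] := Pmu; have := h3 i; have := h4 i.
  case: (eqVneq (nth 0%N mu i)) => [-> _ _|ne_i /= h5 h6]; first by rewrite gtn_eqF.
  by rewrite eqxx; lia.
have size_le mu : P mu -> (size mu <= size la)%N.
  by move=> /andP[/strip_sub /part_sub_size].
have sg_tg mu : P mu -> (-1) ^+ (sumn la - sumn (tg mu)) =
    - (-1) ^+ (sumn la - sumn mu) :> int.
  move=> Pmu; have Pt := P_tg mu Pmu.
  have /andP[/strip_sub/part_sub_sumn le1 _] := Pmu.
  have /andP[/strip_sub/part_sub_sumn le2 _] := Pt.
  have lt_s : (i < size la)%N.
    by rewrite ltnNge; apply: contraTN lt_i => /(nth_default 0%N) ->.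
  have e : (sumn (tg mu) + nth 0 mu i = sumn mu + v mu i)%N.
    rewrite (sumn_part (size_le _ Pt)) (sumn_part (size_le _ Pmu)).
    rewrite (bigD1 (Ordinal lt_s)) //= [in RHS](bigD1 (Ordinal lt_s)) //= nth_tg //.
    rewrite (eq_bigr (fun r : 'I__ => nth 0%N mu r)) => [|r ne_r]; first by lia.
    by rewrite nth_tg // /v -(inj_eq val_inj) /= in ne_r *; rewrite (negPf ne_r).
  have /andP[_ /stripP[h3 h4]] := Pmu; have := h3 i; have := h4 i.
  move: e; rewrite /v eqxx; case: eqP => [->|ne_i] /= e h5 h6.
    have -> : (sumn la - sumn mu = (sumn la - sumn (tg mu)).+1)%N by lia.
    by rewrite exprS mulN1r opprK.
  have -> : (sumn la - sumn (tg mu) = (sumn la - sumn mu).+1)%N by lia.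
  by rewrite exprS mulN1r.
rewrite -big_filter; set fs := filter _ _; rewrite -/P in fs *.
have Pfs mu : mu \in fs -> P mu by rewrite mem_filter => /andP[].
have perm_fs : perm_eq [seq tg mu | mu <- fs] fs.
  have u_fs : uniq fs by apply/filter_uniq/subparts_uniq.
  apply: uniq_perm => //.
    rewrite map_inj_in_uniq // => m1 m2 /Pfs P1 /Pfs P2 e.
    by rewrite -(tgK m1) // e tgK.
  have sub m : m \in fs -> tg m \in fs.
    move=> /Pfs /P_tg Pm; rewrite mem_filter [X in X && _]Pm mem_subparts.
    by case/andP: Pm => /strip_sub.
  move=> m; apply/mapP/idP => [[m' /sub h ->]//|m_fs].
  by exists (tg m); [apply: sub | rewrite tgK // Pfs].
(* The sum equals its opposite, which forces it to vanish over the integers but not in an arbitrary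
   ring; hence the signs in [int], cast into [A] only later. *)
have : \sum_(mu <- fs) (-1) ^+ (sumn la - sumn mu) =
       - \sum_(mu <- fs) (-1) ^+ (sumn la - sumn mu) :> int.
  rewrite -{1}(perm_big _ perm_fs) /= big_map -sumrN big_seq [RHS]big_seq.
  by apply: eq_bigr => mu /Pfs /sg_tg.
set S := \sum_(_ <- _) _; lia.
Qed.

(** The primed letter [N] is expanded in vertical strips and [strip_cancel] applied to each pair of
    successive strips. It is the operator form of the identity H(-y) E(y) = 1 of generating
    functions. *)
Lemma strip_inversion (A : comNzRingType) N k la (x : nat -> A) : (k <= N)%N ->
  \sum_(mu <- subparts la | strip true la mu)
     (- x N) ^+ (sumn la - sumn mu) * tabsum N.+1 k mu empty_part x =
  tabsum N k la empty_part x.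
Proof.
move=> le_kN.
have e mu : strip true la mu ->
    (- x N) ^+ (sumn la - sumn mu) * tabsum N.+1 k mu empty_part x =
    \sum_(nu <- subparts la | strip false mu nu)
      ((-1) ^+ (sumn la - sumn mu) : int)%:~R *
        (x N ^+ (sumn la - sumn nu) * tabsum N k nu empty_part x).
  move=> /strip_sub s; rewrite tabsum_branch ?part_sub0 // ltnNge le_kN /=.
  rewrite (big_subparts _ _ s) mulr_sumr.
  apply: eq_big => [nu|nu /andP[s2 _]].
    by case h: strip; rewrite ?andbF // (strip_sub h).
  have -> : (sumn la - sumn nu = (sumn la - sumn mu) + (sumn mu - sumn nu))%N.
    by have := part_sub_sumn s; have := part_sub_sumn s2; lia.
  by rewrite intr_sign (exprNn (x N)) exprD !mulrA.
rewrite (eq_bigr _ e) (exchange_big_dep predT) //=.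
under eq_bigr do rewrite -mulr_suml -rmorph_sum strip_cancel.
rewrite (big_rem la) ?mem_subparts ?part_sub_refl //= eqxx subnn expr0 !mul1r.
rewrite big_seq_cond big1 ?addr0 // => nu.
rewrite mem_rem_uniq ?subparts_uniq // inE => /andP[/andP[/= /negPf -> _] _].
by rewrite mul0r.
Qed.

(** * Multiplicativity of superization *)

Definition sym_at n (f : symfun) : {mpoly rat[n]} := f n.
#[local] Arguments sym_at : simpl never.

Fact sym_at_is_zmod_morphism n : zmod_morphism (sym_at n).
Proof. by []. Qed.
HB.instance Definition _ n :=
  GRing.isZmodMorphism.Build symfun {mpoly rat[n]} (sym_at n)
    (@sym_at_is_zmod_morphism n).

Fact sym_at_is_monoid_morphism n : monoid_morphism (sym_at n).
Proof. by []. Qed.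
HB.instance Definition _ n :=
  GRing.isMonoidMorphism.Build symfun {mpoly rat[n]} (sym_at n)
    (@sym_at_is_monoid_morphism n).

Fact sym_at_is_scalable n : scalable (sym_at n).
Proof. by []. Qed.
HB.instance Definition _ n :=
  GRing.isScalable.Build rat symfun {mpoly rat[n]} *:%R (sym_at n)
    (@sym_at_is_scalable n).

Lemma sym_at_schur n la : sym_at n (schur la) = tabsum n n la empty_part (xvar n).
Proof. exact: schurE. Qed.

Lemma muni_xvar n i : (i <= n)%N ->
  muni (xvar n.+1 i) = if (i < n)%N then (xvar n i)%:P else 'X.
Proof.
rewrite -ltnS => lt_i; rewrite -[i]/(val (Ordinal lt_i)) xvarE muniE msuppX big_seq1.
rewrite mcoeffX eqxx scale1r /= mnm1E -val_eqE /=.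
case: ltnP => [lt_in|le_ni].
  rewrite ltn_eqF // expr0 alg_polyC (xvarE (Ordinal lt_in)); congr ('X_[_])%:P.
  by apply/mnmP => j; rewrite mnmE !mnm1E -!val_eqE.
have -> : i == n by rewrite eqn_leq le_ni -ltnS lt_i.
rewrite expr1; suff -> :
  [multinom U_(Ordinal lt_i)%MM (widen_ord (leqnSn n) j) | j < n] = 0%MM.
  by rewrite mpolyX0 scale1r.
apply/mnmP => j; rewrite mnmE mnm1E mnm0E -val_eqE /= gtn_eqF //.
exact: leq_trans (ltn_ord j) le_ni.
Qed.

(** The coefficient of t^j is S_la skewed by h_j. *)
Definition skew_schurs (la : part) : {poly symfun} :=
  \sum_(mu <- subparts la | strip true la mu)
     (schur mu)%:P * 'X^(sumn la - sumn mu).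

(* P is the expansion of f(x_1, x_2, ...; t) in powers of the extra variable t. *)
Definition is_expansion (f : symfun) (P : {poly symfun}) :=
  forall n, muni (f n.+1) = map_poly (sym_at n) P.

Lemma expansion_schur la : is_expansion (schur la) (skew_schurs la).
Proof.
move=> n; rewrite schurE.
transitivity (tabsum n.+1 n.+1 la empty_part (@muni n rat \o xvar n.+1)).
  exact: rmorph_tabsum.
rewrite tabsum_branch ?part_sub0 // ltnSn /=.
rewrite /skew_schurs rmorph_sum; apply: eq_bigr => mu _.
rewrite rmorphM /= map_polyC map_polyXn /= muni_xvar // ltnn mulrC; congr (_ * _).
rewrite tabsum_all // -[sym_at n _]/(schur mu n) schurE.
rewrite rmorph_tabsum.
by apply: eq_tabsum => i lt_i; rewrite /= muni_xvar ?(ltnW lt_i) // lt_i.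
Qed.

Lemma expansion_uniq f P Q : is_expansion f P -> is_expansion f Q -> P = Q.
Proof.
move=> hP hQ; apply/polyP => i; apply: symfun_eq => n.
by have := hP n; rewrite hQ => /(congr1 (coefp i)) /=; rewrite !coef_map.
Qed.

Lemma expansionD f g P Q :
  is_expansion f P -> is_expansion g Q -> is_expansion (f + g) (P + Q).
Proof. move=> hP hQ n; rewrite -[symfun_val _ _]/(f n.+1 + g n.+1) muniD hP hQ.
exact/esym/(rmorphD (map_poly (sym_at n))). Qed.

Lemma expansion0 : is_expansion 0 0.
Proof.
move=> n; rewrite -[symfun_val _ _]/(0 : {mpoly rat[n.+1]}) muni0.
exact/esym/(rmorph0 (map_poly (sym_at n))).
Qed.

Lemma expansionM f g P Q :
  is_expansion f P -> is_expansion g Q -> is_expansion (f * g) (P * Q).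
Proof. move=> hP hQ n; rewrite -[symfun_val _ _]/(f n.+1 * g n.+1) muniM hP hQ.
exact/esym/(rmorphM (map_poly (sym_at n))). Qed.

Lemma expansion_alg (a : rat) : is_expansion a%:A (a%:A)%:P.
Proof.
move=> n; rewrite -[symfun_val _ _]/(a *: 1 : {mpoly rat[n.+1]}) muniZ muni1 alg_polyC.
rewrite map_polyC /=; congr polyC.
by rewrite -[sym_at n _]/(a *: 1 : {mpoly rat[n]}) -mul_mpolyC mulr1.
Qed.

Lemma expansionZ (a : rat) f P :
  is_expansion f P -> is_expansion (a *: f) ((a%:A)%:P * P).
Proof.
by move=> hP; rewrite -(mulr_algl a f); apply: expansionM (expansion_alg a) hP.
Qed.

Lemma deg_leW d e f : (d <= e)%N -> deg_le d f -> deg_le e f.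
Proof. by move=> le_de h n; apply: leq_trans (h n) _. Qed.

Lemma deg_leD d f g : deg_le d f -> deg_le d g -> deg_le d (f + g).
Proof.
move=> h1 h2; rewrite -[g]opprK; apply: deg_le_sub => // n.
by rewrite -[symfun_val _ _]/(- g n) msizeN.
Qed.

Lemma deg_le0 d : deg_le d 0.
Proof. by move=> n; rewrite -[symfun_val _ _]/(0 : {mpoly rat[n]}) msize0. Qed.

(** The third clause feeds the induction on the degree in [super_mul]. Since [d - j] is truncated at
    0, the vanishing for [j > d] is recorded separately. *)
Definition graded_expansion d f P :=
  [/\ is_expansion f P, P`_0 = f,
      forall j, deg_le (d - j) P`_j & forall j, (d < j)%N -> P`_j = 0].

Lemma graded_expansion_schur d (la : part) :
  (sumn la <= d)%N -> graded_expansion d (schur la) (skew_schurs la).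
Proof.
move=> le_d; split; first exact: expansion_schur.
- rewrite coef_sum (big_rem la) ?mem_subparts ?part_sub_refl //=.
  have -> : strip true la la by apply/stripP; split=> // r; rewrite part_anti.
  rewrite subnn mulr1 coefC big_seq_cond big1 ?addr0 // => mu.
  rewrite mem_rem_uniq ?subparts_uniq // inE mem_subparts.
  move=> /andP[/andP[/= /eqP ne s] _]; rewrite coefCM coefXn.
  case: eqP => [e|]; rewrite ?mulr0 //; case: ne; apply: part_sub_antisym => //.
  by have := part_sub_sumn s; lia.
- move=> j; rewrite coef_sum big_seq_cond.
  elim/big_ind: _ => [|f g|mu]; [exact: deg_le0 | exact: deg_leD |].
  rewrite mem_subparts => /andP[/part_sub_sumn s _]; rewrite coefCM coefXn.
  case: eqP => [->|_]; rewrite ?mulr0 ?mulr1; last exact: deg_le0.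
  by apply: deg_leW (homog_deg_le (schur_homog mu)); lia.
- move=> j lt_d; rewrite coef_sum big1 // => mu _.
  rewrite coefCM coefXn gtn_eqF ?mulr0 // (leq_ltn_trans _ lt_d) //.
  exact: leq_trans (leq_subr _ _) le_d.
Qed.

Lemma graded_expansion_ex d f : deg_le d f -> exists P, graded_expansion d f P.
Proof.
move=> /schur_span [s].
elim: s f => [|[a la] s IHs] f /= => [_|/andP[le_d /IHs{}IHs]] ->.
  rewrite big_nil; exists 0; split; first exact: expansion0.
  - by rewrite coef0.
  - by move=> j; rewrite coef0; apply: deg_le0.
  - by move=> j _; rewrite coef0.
rewrite big_cons /=; have [P [h1 h2 h3 h4]] := IHs _ erefl.
have [g1 g2 g3 g4] := graded_expansion_schur le_d.
exists ((a%:A)%:P * skew_schurs la + P); split.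
- exact: expansionD (expansionZ a g1) h1.
- by rewrite coefD coefCM g2 h2 mulr_algl.
- by move=> j; rewrite coefD coefCM mulr_algl; apply: deg_leD => //; apply: deg_leZ.
- by move=> j lt_j; rewrite coefD coefCM g4 ?h4 // mulr0 addr0.
Qed.

Lemma expansion_psum r : is_expansion (psum r) ((psum r)%:P + 'X^(r.+1)).
Proof.
move=> n; rewrite rmorphD /= map_polyC map_polyXn /=.
rewrite big_ord_recr rmorphD rmorph_sum !rmorphXn /= -xvarE muni_xvar // ltnn.
congr (_ + _).
rewrite -[sym_at n _]/(\sum_(i < n) 'X_i ^+ r.+1) rmorph_sum; apply: eq_bigr => i _.
by rewrite !rmorphXn /= -xvarE muni_xvar /= ?(ltnW (ltn_ord i)) // ltn_ord xvarE.
Qed.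

Lemma schur_empty : schur empty_part = 1.
Proof. by apply: symfun_eq => n; rewrite schurE tabsum_refl. Qed.

Section Superization.

Variable k : nat.
(** Required for all [N] at once: the inductions below compare a given map in [N.+1] letters with
    some map in [N] letters. *)
Hypothesis super_ex : forall N, exists G : {linear symfun -> {mpoly rat[N]}},
  forall la, G (schur la) = tab_poly N k la empty_part.

Lemma schur_linear_eq (V : lmodType rat) (G G' : {linear symfun -> V}) :
  (forall la, G (schur la) = G' (schur la)) -> G =1 G'.
Proof.
move=> e f; have [d /schur_span[s _ ->]] := symfun_deg f.
by rewrite !linear_sum; apply: eq_bigr => t _; rewrite !linearZ e.
Qed.

Lemma map_poly_coefC (A B : comNzRingType) (G : {additive A -> B}) (a : A) i :
  map_poly G (a%:P * 'X^i) = (G a)%:P * 'X^i.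
Proof.
apply/polyP => j; rewrite coef_map !coefCM !coefXn.
by case: eqP; rewrite ?mulr1 ?mulr0 ?raddf0.
Qed.

(* A primed letter y is removed by substituting -y for an unprimed one. *)
Lemma super_step N (G : {linear symfun -> {mpoly rat[N]}})
    (G' : {linear symfun -> {mpoly rat[N.+1]}}) f P : (k <= N)%N ->
  (forall la, G (schur la) = tab_poly N k la empty_part) ->
  (forall la, G' (schur la) = tab_poly N.+1 k la empty_part) ->
  is_expansion f P -> mwiden (G f) = (map_poly G' P).[- 'X_ord_max].
Proof.
move=> le_kN hG hG'; have [d] := symfun_deg f.
move=> /schur_span [s _ ->] {f}; elim: s P => [|[a la] s IHs] P.
  rewrite big_nil => hP; have -> : P = 0.
    exact: expansion_uniq hP expansion0.
  by rewrite !raddf0 horner0.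
rewrite big_cons /= => hP; set g := \sum_(t <- s) _ in hP IHs *.
have [e] := symfun_deg g; move=> /graded_expansion_ex [Q [hQ _ _ _]].
(* By uniqueness the given expansion is the one built from the Schur expansion of [f], for which the
   strips are explicit. *)
have -> : P = (a%:A)%:P * skew_schurs la + Q.
  exact: expansion_uniq hP (expansionD (expansionZ a (expansion_schur la)) hQ).
rewrite (raddfD (map_poly G')) (linearD G) mwidenD hornerD -(IHs _ hQ); congr (_ + _).
rewrite (linearZZ G) mwidenZ hG /skew_schurs mulr_sumr.
rewrite (raddf_sum (map_poly G')) horner_sum.
rewrite (eq_bigr (fun mu : part => a *: ((- 'X_ord_max) ^+ (sumn la - sumn mu) *
    tab_poly N.+1 k mu empty_part))) => [|mu _]; last first.
  rewrite /= mulrA -polyCM mulr_algl map_poly_coefC /= (linearZZ G') hG'.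
  by rewrite hornerM hornerC hornerXn -scalerAl mulrC.
rewrite -scaler_sumr; congr (_ *: _).
rewrite tab_polyE rmorph_tabsum.
rewrite (@eq_tabsum _ _ _ _ _ _ (xvar N.+1)); last first.
  move=> i lt_i; rewrite /= -[i]/(val (Ordinal lt_i)) xvarE mwidenX mnmwiden1 -xvarE.
  by [].
rewrite -strip_inversion //; apply: eq_bigr => mu _.
by rewrite tab_polyE -[N in xvar _ N]/(val (@ord_max N)) xvarE.
Qed.

Lemma super_unprimed N (G : {linear symfun -> {mpoly rat[N]}}) : (N <= k)%N ->
  (forall la, G (schur la) = tab_poly N k la empty_part) -> G =1 sym_at N.
Proof.
move=> le_Nk hG; apply: schur_linear_eq => la.
by rewrite hG; apply: etrans (esym (sym_at_schur _ _)); rewrite tab_polyE tabsum_all.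
Qed.

(** With P and Q the expansions of f and g, [super_step] and the case of [N] letters show that G'(P)
    G'(Q) and G'(P Q) agree at -y. Their coefficients of positive powers agree by induction on the
    degree, so the difference is the constant G'(f) G'(g) - G'(f g), and it is zero. *)
Lemma super_mul N (G : {linear symfun -> {mpoly rat[N]}}) :
  (forall la, G (schur la) = tab_poly N k la empty_part) ->
  forall f g, G (f * g) = G f * G g.
Proof.
elim: N G => [|N IHN] G' hG'.
  by move=> f g; rewrite !(super_unprimed (leq0n k) hG') rmorphM.
have [lt_Nk|le_kN] := ltnP N k.
  by move=> f g; rewrite !(super_unprimed lt_Nk hG') rmorphM.
have [G hG] := super_ex N.
suff mulG d : forall a b f g, (a + b < d)%N -> deg_le a f -> deg_le b g ->
    G' (f * g) = G' f * G' g.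
  move=> f g; have [a da] := symfun_deg f; have [b db] := symfun_deg g.
  exact: mulG (ltnSn _) da db.
elim: d => // d IHd a b f g lt_d da db.
have [P [hP P0 dP zP]] := graded_expansion_ex da.
have [Q [hQ Q0 dQ zQ]] := graded_expansion_ex db.
have /eqP := super_step le_kN hG hG' (expansionM hP hQ).
rewrite (IHN G hG) mwidenM (super_step le_kN hG hG' hP) (super_step le_kN hG hG' hQ).
rewrite -hornerM -subr_eq0 -hornerN -hornerD.
suff -> : map_poly G' P * map_poly G' Q - map_poly G' (P * Q) =
   (G' f * G' g - G' (f * g))%:P by rewrite hornerC subr_eq0 => /eqP.
apply/polyP => j; rewrite coefC coefB coef_map !coefM.
case: eqP => [->|/eqP j0]; first by rewrite !big_ord1 !coef_map P0 Q0.
rewrite raddf_sum -sumrB big1 // => i _; rewrite !coef_map; apply/eqP.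
rewrite subr_eq0; apply/eqP/esym; have := ltn_ord i; rewrite ltnS => le_ij.
have [lt_a|le_a] := ltnP a i; first by rewrite zP // mul0r !raddf0 mul0r.
have [lt_b|le_b] := ltnP b (j - i); first by rewrite zQ // mulr0 !raddf0 mulr0.
(* Here [i <= a] and [j - i <= b], so the two degree bounds add up to a + b - j, smaller than a + b
   because [j] is positive. *)
by apply: (IHd (a - i)%N (b - (j - i))%N) => //; lia.
Qed.

Lemma super_one N (G : {linear symfun -> {mpoly rat[N]}}) :
  (forall la, G (schur la) = tab_poly N k la empty_part) -> G 1 = 1.
Proof. by move=> hG; rewrite -schur_empty hG tab_polyE tabsum_refl. Qed.

(** For a primed letter y, [super_step] reads G(p) = G'(p) + (-y)^(r+1) with p = [psum r], because
    p(X, t) = p(X) + t^(r+1). *)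
Lemma super_psum N (G : {linear symfun -> {mpoly rat[N]}}) r :
  (forall la, G (schur la) = tab_poly N k la empty_part) ->
  G (psum r) = \sum_(i < N) (if (i < k)%N then 'X_i ^+ r.+1 else - (- 'X_i) ^+ r.+1).
Proof.
elim: N G => [|N IHN] G' hG'.
  rewrite (super_unprimed (leq0n k) hG').
  by rewrite -[LHS]/(\sum_(i < 0) 'X_i ^+ r.+1) !big_ord0.
have [lt_Nk|le_kN] := ltnP N k.
  rewrite (super_unprimed lt_Nk hG') -[LHS]/(\sum_(i < N.+1) 'X_i ^+ r.+1).
  apply: eq_bigr => i _.
  by rewrite (leq_trans (ltn_ord i)).
have [G hG] := super_ex N.
have := super_step le_kN hG hG' (expansion_psum r).
rewrite raddfD /= map_polyC -['X^_]mul1r map_poly_coefC /= super_one //.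
rewrite hornerD hornerC mul1r hornerXn => /esym/(canRL (addrK _)) ->.
rewrite big_ord_recr /= ltnNge le_kN /=; congr (_ - _).
rewrite (IHN G hG) raddf_sum; apply: eq_bigr => i _ /=.
have wX : mwiden 'X_i = 'X_(widen_ord (leqnSn N) i) :> {mpoly rat[N.+1]}.
  by rewrite mwidenX mnmwiden1.
by case: ifP => _; rewrite ?mwidenN rmorphXn /= ?mwidenN wX.
Qed.

End Superization.

(** * Newton's identities *)

Lemma nth_row_part n i : nth 0%N (row_part n) i = if i == 0%N then n else 0%N.
Proof. by case: n => [|n]; case: i => [|[|i]]. Qed.

Lemma sumn_row_part n : sumn (row_part n) = n.
Proof. by case: n => //= n; rewrite addn0. Qed.

Lemma row_part_sub m n : part_sub (row_part m) (row_part n) = (m <= n)%N.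
Proof.
apply/part_subP/idP => [/(_ 0%N)|le_mn i]; first by rewrite !nth_row_part.
by rewrite !nth_row_part; case: eqP.
Qed.

Lemma row_part_inj : injective row_part.
Proof. by move=> m n /(congr1 (sumn \o parts)) /=; rewrite !sumn_row_part. Qed.

Lemma big_subparts_row (R : nmodType) n (P : pred part) (F : part -> R) :
  \sum_(nu <- subparts (row_part n) | P nu) F nu =
  \sum_(m < n.+1 | P (row_part m)) F (row_part m).
Proof.
rewrite -(big_mkord (fun m => P (row_part m)) (fun m => F (row_part m))).
rewrite -(big_map row_part P F); apply: perm_big; apply: uniq_perm.
- exact: subparts_uniq.
- by rewrite (map_inj_uniq row_part_inj) iota_uniq.
move=> nu; rewrite mem_subparts; apply/idP/mapP => [|[m m_in ->]]; last first.
  by rewrite row_part_sub; move: m_in; rewrite mem_index_iota.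
move=> /part_subP h; exists (nth 0 nu 0)%N.
  by rewrite mem_index_iota ltnS; have := h 0%N; rewrite nth_row_part.
apply: part_ext => i; rewrite nth_row_part; case: eqP => [->//|i0].
by have := h i; rewrite nth_row_part; case: eqP => // _; rewrite leqn0 => /eqP.
Qed.

Section Newton.

Variables (A : comNzRingType) (x : nat -> A).

(** The complete homogeneous polynomial h_n in [N] variables. *)
Definition hsf N n : A := tabsum N N (row_part n) empty_part x.

(** The elementary polynomial e_n in [N] variables. The recursive form suits both identifications
    made below: with rows of primed letters in [esf_tabsum], and with [mesym] in [mesym_esf]. *)
Fixpoint esf N n : A :=
  match N, n with
  | _, 0 => 1
  | 0, _.+1 => 0
  | N'.+1, n'.+1 => esf N' n'.+1 + x N' * esf N' n'
  end.

Definition powsum N r : A := \sum_(i < N) x i ^+ r.+1.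

Lemma hsf0 N : hsf N 0 = 1.
Proof. by rewrite /hsf (_ : row_part 0 = empty_part) ?tabsum_refl //; apply/val_inj. Qed.

Lemma hsf0n n : hsf 0 n.+1 = 0.
Proof.
by rewrite /hsf tabsum0 ?part_sub0.
Qed.

Lemma esf0 N : esf N 0 = 1. Proof. by case: N. Qed.

Lemma hsf_sum N n : hsf N.+1 n = \sum_(m < n.+1) x N ^+ (n - m) * hsf N m.
Proof.
rewrite /hsf tabsum_branch ?part_sub0 // big_subparts_row.
apply: eq_big => [m|m _]; last by rewrite !sumn_row_part tabsum_all.
rewrite ltnSn /=; apply/stripP; split=> r /=; rewrite !nth_row_part //.
by case: eqP => // _; rewrite -ltnS.
Qed.

Lemma hsfS N n : hsf N.+1 n.+1 = hsf N n.+1 + x N * hsf N.+1 n.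
Proof.
rewrite !hsf_sum big_ord_recr /= subnn expr0 mul1r addrC; congr (_ + _).
rewrite mulr_sumr; apply: eq_bigr => m _.
by rewrite mulrA -exprS subSn // -ltnS.
Qed.

Lemma esf_tabsum N n j : (j <= n)%N ->
  tabsum N 0 (row_part n) (row_part j) x = esf N (n - j).
Proof.
elim: N n => [|N IHN] n le_jn.
  rewrite tabsum0 ?row_part_sub // (inj_eq row_part_inj).
  by case: ltngtP le_jn => // [lt_jn _|-> _]; [rewrite -(subnSK lt_jn) | rewrite subnn].
rewrite tabsum_branch ?row_part_sub // big_subparts_row /=.
rewrite (eq_bigl (fun m : 'I_n.+1 => (j <= m <= n) && (n <= m.+1))%N); last first.
  move=> m; have -> : (m <= n)%N by rewrite -ltnS.
  rewrite row_part_sub andbT; congr (_ && _).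
  apply/stripP/idP => /= [[_ /(_ 0%N)]|h]; first by rewrite !nth_row_part.
  by split=> r; rewrite !nth_row_part; case: eqP => // _; rewrite -ltnS.
(* Only [m = n] and [m = n - 1] survive, the last primed letter being absent or used once; the
   latter also requires [j < n]. *)
rewrite big_mkcond big_ord_recr /= leqnn leqnSn le_jn /= subnn mul1r sumn_row_part.
rewrite IHN // addrC -big_mkcond /=.
case: n le_jn => [|n] le_jn.
  by rewrite sub0n esf0 big_ord0 addr0.
rewrite big_mkcond big_ord_recr /= leqnn andbT big1 ?add0r => [|m _]; last first.
  by rewrite [(n < _)%N]ltnNge ltn_ord andbF.
rewrite leqnSn andbT; case: (ltnP n j) => [lt_nj|le_j].
  have -> : j = n.+1 by apply/eqP; rewrite eqn_leq le_jn.
  by rewrite subnn !esf0 addr0.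
by rewrite !sumn_row_part IHN // subSn // subSnn /=.
Qed.

(** Induction on the number of variables, then on [n]: the recurrence [hsfS] is combined with p_r(X,
    t) = p_r(X) + t^r. *)
Lemma newton_h N n :
  \sum_(i < n.+1) powsum N i * hsf N (n - i) = hsf N n.+1 *+ n.+1.
Proof.
elim: N n => [|N IHN] n.
  rewrite hsf0n mul0rn big1 // => i _.
  by rewrite /powsum big_ord0 mul0r.
have pS r : powsum N.+1 r = powsum N r + x N ^+ r.+1 by rewrite /powsum big_ord_recr.
elim: n => [|n IHn].
  rewrite big_ord1 hsfS !hsf0 pS !mulr1 expr1 mulr1n; congr (_ + _).
  by have := IHN 0%N; rewrite big_ord1 hsf0 mulr1.
have split_p m : \sum_(i < m.+1) powsum N.+1 i * hsf N.+1 (m - i) =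
    \sum_(i < m.+1) powsum N i * hsf N.+1 (m - i) +
    \sum_(i < m.+1) x N ^+ i.+1 * hsf N.+1 (m - i).
  by rewrite -big_split; apply: eq_bigr => i _; rewrite pS mulrDl.
have e1 : \sum_(i < n.+2) powsum N i * hsf N.+1 (n.+1 - i) =
    \sum_(i < n.+2) powsum N i * hsf N (n.+1 - i) +
    x N * \sum_(i < n.+1) powsum N i * hsf N.+1 (n - i).
  rewrite big_ord_recr [in RHS]big_ord_recr /= subnn !hsf0 addrAC; congr (_ + _).
  rewrite mulr_sumr -big_split; apply: eq_bigr => i _ /=.
  by rewrite subSn -1?ltnS // hsfS mulrDr [x N * (_ * _)]mulrCA.
have e2 : \sum_(i < n.+2) x N ^+ i.+1 * hsf N.+1 (n.+1 - i) =
    x N * hsf N.+1 n.+1 + x N * \sum_(i < n.+1) x N ^+ i.+1 * hsf N.+1 (n - i).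
  rewrite big_ord_recl; congr (_ + _); rewrite mulr_sumr; apply: eq_bigr => i _.
  by rewrite lift0 subSS mulrA -exprS.
rewrite hsfS mulrnDl -mulrnAr [hsf N.+1 n.+1 *+ _]mulrS -IHn !split_p e1 e2 IHN.
by rewrite !mulrDr; ring.
Qed.

(** With E_N the generating function of the e_n in [N] variables, this expands E_N = E_(N+1) / (1 +
    x_N t) as a geometric series. *)
Lemma esf_unwind N n :
  \sum_(i < n.+1) (- x N) ^+ i * esf N.+1 (n - i) = esf N n.
Proof.
elim: n => [|n IHn]; first by rewrite big_ord1 mul1r subn0 !esf0.
rewrite big_ord_recl /= mul1r -[RHS](addrK (x N * esf N n)); congr (_ + _).
rewrite -mulNr -IHn mulr_sumr; apply: eq_bigr => i _.
by rewrite /bump /= add1n subSS exprS mulrA.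
Qed.

Lemma newton_e N n :
  \sum_(i < n.+1) (-1) ^+ i * powsum N i * esf N (n - i) = esf N n.+1 *+ n.+1.
Proof.
elim: N n => [|N IHN] n.
  by rewrite mul0rn big1 // => i _; rewrite /powsum big_ord0 mulr0 mul0r.
have pS r : powsum N.+1 r = powsum N r + x N ^+ r.+1 by rewrite /powsum big_ord_recr.
rewrite (eq_bigr (fun i : 'I_n.+1 => (-1) ^+ i * powsum N i * esf N.+1 (n - i) +
    x N * ((- x N) ^+ i * esf N.+1 (n - i)))); last first.
  by move=> i _; rewrite pS exprS (exprNn (x N)); ring.
rewrite big_split /= -mulr_sumr esf_unwind.
have -> : \sum_(i < n.+1) (-1) ^+ i * powsum N i * esf N.+1 (n - i) =
    esf N n.+1 *+ n.+1 + x N * (esf N n *+ n).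
  rewrite -IHN; case: n => [|n].
    by rewrite !big_ord1 !esf0 mulr0n mulr0 addr0.
  rewrite -IHN mulr_sumr big_ord_recr /= [in RHS]big_ord_recr /= subnn !esf0.
  rewrite addrAC; congr (_ + _); rewrite -big_split; apply: eq_bigr => i _ /=.
  by rewrite subSn -1?ltnS //=; ring.
by rewrite /= mulrnDl [(x N * _) *+ _]mulrSr -mulrnAr addrA.
Qed.

End Newton.

(** * Power sums span *)

Lemma part_cat_proof (la mu : part) : is_part (sort geq (la ++ mu)).
Proof.
apply/andP; split.
  by apply: sort_sorted => m n; rewrite /geq /= orbC leq_total.
rewrite mem_sort mem_cat negb_or.
by case: la mu => [s /= /andP[_ ->]] [t /= /andP[_ ->]].
Qed.

Definition part_cat la mu : part := Part (part_cat_proof la mu).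

Lemma psum_part_cat la mu : psum_part (part_cat la mu) = psum_part la * psum_part mu.
Proof.
by rewrite /psum_part -big_cat; apply: perm_big; rewrite perm_sort.
Qed.

Lemma psum_part_row r : psum_part (row_part r.+1) = psum r.
Proof. by rewrite /psum_part big_seq1. Qed.

Lemma psum_part_empty : psum_part empty_part = 1.
Proof. by rewrite /psum_part big_nil. Qed.

Lemma powsumE n r : powsum (xvar n) n r = psum r n.
Proof. by apply: eq_bigr => i _; rewrite xvarE. Qed.

Lemma rmorph_esf (A B : comNzRingType) (f : {rmorphism A -> B}) (x : nat -> A) N n :
  f (esf x N n) = esf (f \o x) N n.
Proof.
elim: N n => [|N IHN] [|n]; rewrite /= ?rmorph1 ?rmorph0 //.
by rewrite rmorphD rmorphM !IHN.
Qed.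

Lemma eq_esf (A : comNzRingType) (x y : nat -> A) N n :
  (forall i, (i < N)%N -> x i = y i) -> esf x N n = esf y N n.
Proof.
elim: N n => [|N IHN] [|n] e //=.
by rewrite e // !IHN // => i lt_i; apply: e; apply: ltnW.
Qed.

Lemma mwiden_xvar n i : (i < n)%N -> mwiden (xvar n i) = xvar n.+1 i.
Proof.
move=> lt_i; rewrite -[i]/(val (Ordinal lt_i)) xvarE mwidenX mnmwiden1 -xvarE.
by [].
Qed.

Lemma mesym_esf n k : mesym n rat k = esf (xvar n) n k.
Proof.
elim: n k => [|n IHn] [|k]; rewrite ?mesym0E //; first by rewrite mesym_geqnE.
have e m : mwiden (esf (xvar n) n m) = esf (xvar n.+1) n m.
  rewrite (rmorph_esf (@mwiden n rat)); apply: eq_esf => i lt_i.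
  exact: mwiden_xvar.
by rewrite mesymSS !IHn !e mulrC -(xvarE (@ord_max n)).
Qed.

Section SpanAt.

Variable n : nat.
Let B la := psum_part la n.

Lemma psum_spanM f g : in_span B predT f -> in_span B predT g -> in_span B predT (f * g).
Proof.
move=> [s _ ->] [t _ ->]; rewrite mulr_suml; apply: in_span_sum => u _.
rewrite mulr_sumr; apply: in_span_sum => v _.
rewrite -scalerAl -scalerAr; do 2!apply: in_spanZ.
rewrite -[B _ * B _]/((psum_part u.2 * psum_part v.2) n) -psum_part_cat.
exact: (in_span_base B).
Qed.

Lemma psum_span1 : in_span B predT 1.
Proof.
rewrite (_ : 1 = B empty_part); first exact: in_span_base.
by rewrite /B psum_part_empty.
Qed.

Lemma psum_spanX f k : in_span B predT f -> in_span B predT (f ^+ k).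
Proof.
by move=> h; elim: k => [|k IHk]; [exact: psum_span1 | rewrite exprS; apply: psum_spanM].
Qed.

(** Newton's identity determines e_(k+1) from the earlier ones after division by k + 1, which is
    possible over [rat]. *)
Lemma psum_span_mesym k : in_span B predT (mesym n rat k).
Proof.
elim/ltn_ind: k => -[|k] IHk; first by rewrite mesym0E; apply: psum_span1.
have -> : mesym n rat k.+1 = k.+1%:R^-1 *: (mesym n rat k.+1 *+ k.+1).
  by rewrite -scaler_nat scalerA mulVf ?scale1r // pnatr_eq0.
apply: in_spanZ; rewrite mesym_esf -newton_e; apply: in_span_sum => i _.
rewrite -mesym_esf; apply: psum_spanM; last by apply: IHk; rewrite ltnS leq_subr.
rewrite -signr_odd mulr_sign powsumE.
have h : in_span B predT (psum i n).
  by rewrite -psum_part_row; apply: (in_span_base B).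
by case: ifP => // _; rewrite -scaleN1r; apply: in_spanZ.
Qed.

Lemma psum_span_sym f : f \is symmetric -> in_span B predT f.
Proof.
move=> /sym_fundamental [t [<- _]]; rewrite comp_mpolyEX; apply: in_span_sum => m _.
apply: in_spanZ; rewrite comp_mpolyX; elim/big_ind: _ => [||i _].
- exact: psum_span1.
- exact: psum_spanM.
by apply: psum_spanX; rewrite tnth_mktuple; apply: psum_span_mesym.
Qed.

End SpanAt.

Lemma psum_part_homog (la : part) : homogeneous (sumn la) (psum_part la).
Proof.
move=> n; have : 0%N \notin (la : seq nat) by case: la => s /= /andP[].
rewrite /psum_part; elim: (la : seq nat) => [|a s IHs] /=; first by rewrite big_nil dhomog1.
rewrite inE negb_or big_cons => /andP[a0 /IHs h].
apply: dhomogM h; apply: rpred_sum => i _.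
case: a a0 => // a _ /=; rewrite mpolyXn dhomogX.
by rewrite -[X in X == _]/(mdeg (U_(i) *+ a.+1)%MM) mdegMn mdeg1 mul1n.
Qed.

(** A spanning relation for the polynomial [f d] may involve terms of degree above [d]. Taking
    homogeneous components discards them, and then [deg_le_eq] lifts the relation from [d] variables
    to symmetric functions. *)
Lemma psum_span d f : deg_le d f -> in_span psum_part (fun la => sumn la <= d)%N f.
Proof.
move=> df; have [sym_f _ _] := symfunP f.
have [s _ es] := psum_span_sym (sym_f d).
exists [seq t : rat * part <- s | (sumn t.2 <= d)%N]; first exact: filter_all.
rewrite big_filter; apply: (deg_le_eq df).
  elim/big_ind: _ => [|u v|t le_d]; [exact: deg_le0 | exact: deg_leD |].
  by apply/deg_leZ/(deg_leW le_d)/homog_deg_le/psum_part_homog.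
rewrite (pihomog_partitionE (df d)) es symfun_sumE.
under eq_bigr do rewrite linear_sum.
rewrite exchange_big [RHS]big_mkcond; apply: eq_bigr => t _ /=.
under eq_bigr do rewrite linearZ.
rewrite -scaler_sumr; have ht := psum_part_homog t.2 d.
case: leqP => [le_d|lt_d].
  rewrite (bigD1 (Ordinal (n := d.+1) le_d)) //= pihomog_dE // big1 ?addr0 // => i ne.
  by apply: pihomog_ne0 ht; rewrite -val_eqE eq_sym in ne.
rewrite big1 ?scaler0 // => i _; apply: pihomog_ne0 ht.
by rewrite neq_ltn orbC (leq_ltn_trans _ lt_d) // -ltnS.
Qed.

Lemma psum_span_homog d f : homogeneous d f ->
  in_span psum_part (fun la => sumn la == d)%N f.
Proof.
move=> hf; have [s _ es] := psum_span (homog_deg_le hf).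
exists [seq t : rat * part <- s | sumn t.2 == d]; first exact: filter_all.
rewrite big_filter; apply: symfun_eq => n.
rewrite -[LHS](pihomog_dE (hf n)) es !symfun_sumE linear_sum [RHS]big_mkcond.
apply: eq_bigr => t _; have ht := psum_part_homog t.2 n.
rewrite -[symfun_val (t.1 *: _) n]/(t.1 *: psum_part t.2 n) linearZ /=.
case: eqP => [<-|/eqP ne]; first by rewrite pihomog_dE.
by rewrite (pihomog_ne0 ne ht) scaler0.
Qed.

(** * Expansion of complete functions in power sums *)

Lemma perm_part (la mu : part) : perm_eq la mu -> la = mu.
Proof.
move=> h; apply/val_inj/(sorted_eq (leT := geq)) => //.
- by move=> x y z; rewrite /geq /= => h1 h2; apply: leq_trans h2 h1.
- by move=> x y; rewrite /geq /= => /andP[h1 h2]; apply/eqP; rewrite eqn_leq h2.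
- by case: la {h} => s /= /andP[].
- by case: mu {h} => s /= /andP[].
Qed.

Lemma rem_part_proof (la : part) r : is_part (rem r la).
Proof.
case: la => s /= /andP[ss s0]; apply/andP; split.
  apply: subseq_sorted ss; last exact: rem_subseq.
  by move=> x y z; rewrite /geq /= => h1 h2; apply: leq_trans h2 h1.
by apply: contra s0; apply: mem_rem.
Qed.

Definition rem_part r la : part := Part (rem_part_proof la r).
Definition add_part r la : part := part_cat (row_part r) la.

Lemma perm_add_part r la : perm_eq (add_part r.+1 la) (r.+1 :: la).
Proof. by rewrite /= perm_sort. Qed.

Lemma rem_partK r (la : part) :
  r.+1 \in (la : seq nat) -> add_part r.+1 (rem_part r.+1 la) = la.
Proof.
move=> r_la; apply: perm_part; apply: perm_trans (perm_add_part _ _) _.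
by rewrite perm_sym perm_to_rem.
Qed.

Lemma add_part_inj r : injective (add_part r.+1).
Proof.
move=> la mu e; apply: perm_part; rewrite -(perm_cons r.+1).
apply: perm_trans (perm_add_part r mu); rewrite -e perm_sym; exact: perm_add_part.
Qed.

Lemma sumn_add_part r la : sumn (add_part r.+1 la) = (r.+1 + sumn la)%N.
Proof. by rewrite (perm_sumn (perm_add_part r la)). Qed.

Lemma psum_add_part r la : psum_part (add_part r.+1 la) = psum r * psum_part la.
Proof. by rewrite psum_part_cat psum_part_row. Qed.

Lemma mem_part_le (la : part) p : p \in (la : seq nat) -> (0 < p <= sumn la)%N.
Proof.
move=> p_la; apply/andP; split.
  by rewrite lt0n; apply: contraTneq p_la => ->; case: (la) => s /= /andP[].
by rewrite (perm_sumn (perm_to_rem p_la)) leq_addr.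
Qed.

Lemma part_size_le (la : part) : (size la <= sumn la)%N.
Proof.
rewrite (sumn_part (leqnn _)) -[X in (X <= _)%N]card_ord -sum1_card.
by apply: leq_sum => i _; apply: Defs.part_gt0.
Qed.

Lemma box_partP n : is_part (nseq n n).
Proof.
rewrite /is_part mem_nseq; apply/andP; split; last by case: n.
apply/(sortedP 0%N) => i; rewrite size_nseq => lt_i.
by rewrite !nth_nseq lt_i (ltnW lt_i) /geq /=.
Qed.

(** All partitions of n lie in the n by n square, which provides a finite list to filter. *)
Definition parts_of (n : nat) : seq part :=
  [seq la <- subparts (Part (box_partP n)) | sumn (la : part) == n].

Lemma mem_parts_of n (la : part) : (la \in parts_of n) = (sumn la == n).
Proof.
rewrite mem_filter mem_subparts andb_idr // => /eqP e; apply/part_subP => i /=.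
rewrite nth_nseq; have [lt_i|le_i] := ltnP i (size la); last by rewrite nth_default.
have -> : (i < n)%N by rewrite -e (leq_trans lt_i) // part_size_le.
by have /andP[_] := mem_part_le (mem_nth 0%N lt_i); rewrite e.
Qed.

Lemma parts_of_uniq n : uniq (parts_of n).
Proof. exact/filter_uniq/subparts_uniq. Qed.

Lemma zcoefE (la : part) L : (head 0 la < L)%N ->
  zcoef la = (\prod_(1 <= i < L) (i ^ count_mem i la * (count_mem i la)`!))%N.
Proof.
move=> lt_L; rewrite /zcoef (big_cat_nat (n := (head 0%N la).+1) _ lt_L) //=.
rewrite -[LHS]muln1; congr (_ * _)%N; apply/esym.
rewrite big_nat big1 // => i /andP[gt_i _].
rewrite (count_memPn _) //; apply/negP => /(nthP 0%N) [j _ e].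
by have := part_head la j; rewrite e leqNgt gt_i.
Qed.

Lemma zcoef_gt0 la : (0 < zcoef la)%N.
Proof.
rewrite /zcoef big_nat; apply: prodn_cond_gt0 => i /andP[i0 _].
by rewrite muln_gt0 expn_gt0 i0 fact_gt0.
Qed.

Lemma zcoef_add_part r la : zcoef (add_part r.+1 la) =
  (r.+1 * count_mem r.+1 (add_part r.+1 la) * zcoef la)%N.
Proof.
pose L := (maxn r.+1 (maxn (head 0 la) (head 0 (add_part r.+1 la)))).+1.
rewrite (zcoefE (L := L)); last by rewrite /L ltnS !leq_max leqnn !orbT.
rewrite (zcoefE (la := la) (L := L)); last by rewrite /L ltnS !leq_max leqnn !orbT.
have cE i : count_mem i (add_part r.+1 la) = ((r.+1 == i) + count_mem i la)%N.
  by rewrite (seq.permP (perm_add_part r la)).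
have r_in : r.+1 \in index_iota 1 L by rewrite mem_index_iota /= /L ltnS leq_max leqnn.
rewrite (bigD1_seq r.+1) ?iota_uniq //= [in RHS](bigD1_seq r.+1) ?iota_uniq //=.
rewrite !cE eqxx add1n expnS factS.
rewrite (eq_bigr (fun i => i ^ count_mem i la * (count_mem i la)`!)%N).
  by rewrite -!mulnA; congr (_ * _)%N; rewrite mulnCA.
by move=> i ne; rewrite cE eq_sym (negPf ne).
Qed.

Lemma sumn_count (s : seq nat) n : (forall p, p \in s -> 0 < p <= n)%N ->
  sumn s = (\sum_(i < n) i.+1 * count_mem i.+1 s)%N.
Proof.
elim: s => [|a s IHs] h /=; first by rewrite big1 // => i _; rewrite muln0.
rewrite IHs => [|p p_s]; last by apply: h; rewrite inE p_s orbT.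
have /andP[a0 le_a] := h a (mem_head _ _).
have lt_a : (a.-1 < n)%N by rewrite prednK.
rewrite [in RHS](eq_bigr (fun i : 'I_n => (if i == Ordinal lt_a then a else 0) +
   i.+1 * count_mem i.+1 s)%N); last first.
  move=> i _; rewrite mulnDr -val_eqE /= -[in RHS](prednK a0) -(prednK a0) /= eqSS eq_sym.
  by case: eqP => [->|]; rewrite ?muln1 ?muln0.
rewrite [RHS]big_split; congr addn.
by rewrite (bigD1 (Ordinal lt_a)) //= eqxx big1 ?addn0 // => i /negPf ->.
Qed.

Definition zsum (n : nat) : symfun :=
  \sum_(la <- parts_of n) (zcoef la)%:R^-1 *: psum_part la.

Lemma zsum0 : zsum 0 = 1.
Proof.
have e : perm_eq (parts_of 0) [:: empty_part].
  apply: uniq_perm; rewrite ?parts_of_uniq // => la; rewrite mem_parts_of inE.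
  apply/eqP/eqP => [e|->//]; apply: part_sub_antisym; last by rewrite e.
  apply/part_subP => i; rewrite nth_nil.
  have [lt_i|le_i] := ltnP i (size la); last by rewrite nth_default.
  by have /andP[_] := mem_part_le (mem_nth 0%N lt_i); rewrite e.
rewrite /zsum (perm_big _ e) big_seq1 psum_part_empty /zcoef big_geq //.
by rewrite invr1 scale1r.
Qed.

(** In the term of la, n + 1 is written as the sum of i m_i over the part sizes i. Removing one part
    i divides z_la by i m_i, which absorbs this factor and leaves the term of a smaller
    partition. *)
Lemma zsum_rec n : zsum n.+1 *+ n.+1 = \sum_(i < n.+1) psum i * zsum (n - i).
Proof.
pose F (i : nat) (la : part) : symfun :=
  ((i.+1 * count_mem i.+1 la)%:R / (zcoef la)%:R) *: psum_part la.
transitivity (\sum_(la <- parts_of n.+1) \sum_(i < n.+1) F i la).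
  rewrite /zsum -sumrMnl big_seq [RHS]big_seq; apply: eq_bigr => la.
  rewrite mem_parts_of => /eqP e; rewrite /F -scaler_suml -mulr_suml -natr_sum.
  rewrite -sumn_count ?e; first by rewrite -scaler_nat scalerA.
  by move=> p p_la; rewrite -e; apply: mem_part_le.
rewrite exchange_big /=; apply: eq_bigr => i _.
rewrite (bigID (fun la : part => i.+1 \in (la : seq nat))) /=.
rewrite [X in _ + X]big1 ?addr0 => [|la /count_memPn c0]; last first.
  by rewrite /F c0 muln0 mul0r scale0r.
have le_i : (i <= n)%N by rewrite -ltnS.
have perm_i : perm_eq [seq la : part <- parts_of n.+1 | i.+1 \in (la : seq nat)]
    [seq add_part i.+1 mu | mu <- parts_of (n - i)].
  apply: uniq_perm; first exact/filter_uniq/parts_of_uniq.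
    by rewrite map_inj_uniq ?parts_of_uniq //; apply: add_part_inj.
  move=> la; rewrite mem_filter mem_parts_of; apply/andP/mapP => [[i_la /eqP e]|[mu]].
    exists (rem_part i.+1 la); last by rewrite rem_partK.
    rewrite mem_parts_of; have := sumn_add_part i (rem_part i.+1 la).
    by rewrite rem_partK // e addSn => -[e']; rewrite -(eqn_add2l i) subnKC // -e'.
  rewrite mem_parts_of => /eqP e ->; rewrite sumn_add_part e.
  rewrite (perm_mem (perm_add_part _ _)) mem_head; split=> //.
  by rewrite addSn subnKC.
rewrite -big_filter (perm_big _ perm_i) big_map /zsum mulr_sumr; apply: eq_bigr => mu _.
rewrite /F zcoef_add_part psum_add_part -scalerAr; congr (_ *: _).
rewrite [in X in _ / X]natrM invfM mulrA divff ?mul1r // pnatr_eq0 muln_eq0 negb_or /=.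
by rewrite -lt0n -has_count has_pred1 (perm_mem (perm_add_part _ _)) mem_head.
Qed.

Lemma schur_rowE N n : schur (row_part n) N = hsf (xvar N) N n.
Proof. exact: schurE. Qed.

Lemma symfunMnE (f : symfun) k N : (f *+ k) N = f N *+ k.
Proof. exact: (raddfMn (sym_at N)). Qed.

Lemma schur_row_rec n :
  schur (row_part n.+1) *+ n.+1 = \sum_(i < n.+1) psum i * schur (row_part (n - i)).
Proof.
apply: symfun_eq => N; rewrite symfun_sumE.
rewrite symfunMnE schur_rowE -newton_h.
apply: eq_bigr => i _; rewrite powsumE -[RHS]/(psum i N * schur (row_part (n - i)) N).
by rewrite schur_rowE.
Qed.

Lemma schur_row_zsum n : schur (row_part n) = zsum n.
Proof.
elim/ltn_ind: n => -[|n] IHn.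
  by rewrite zsum0 -schur_empty; congr schur; apply/val_inj.
have e : schur (row_part n.+1) *+ n.+1 = zsum n.+1 *+ n.+1.
  rewrite schur_row_rec zsum_rec; apply: eq_bigr => i _.
  by rewrite IHn // ltnS leq_subr.
have n0 : n.+1%:R != 0 :> rat by rewrite pnatr_eq0.
by apply: (scalerI n0); rewrite !scaler_nat.
Qed.

(** * Hook shapes *)

Lemma nth_hook_part a b r :
  nth 0%N (hook_part a b) r = if r == 0%N then a.+1 else (r <= b)%N : nat.
Proof. by case: r => [|r] //=; rewrite nth_nseq; case: ltnP. Qed.

Lemma sumn_hook_part a b : sumn (hook_part a b) = (a + b).+1.
Proof. by rewrite /= sumn_nseq mul1n addSn. Qed.

Lemma hook_part_inj a a' b b' : hook_part a b = hook_part a' b' -> a = a' /\ b = b'.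
Proof.
move=> e; have ea : a = a' by have := congr1 (fun la : part => nth 0%N la 0) e => /= -[].
split=> //; apply/eqP; rewrite -(eqn_add2l a) -eqSS -sumn_hook_part.
by rewrite e sumn_hook_part -ea.
Qed.

Lemma hook_part0 a : hook_part a 0 = row_part a.+1.
Proof. exact/val_inj. Qed.

Section Hooks.

Variables (A : comNzRingType) (x : nat -> A).

Definition hookf N a b : A := tabsum N N (hook_part a b) empty_part x.

(** A horizontal strip takes some cells of the arm and at most the last cell of the leg; as the leg
    is not empty, the corner stays. *)
Lemma hook_strip a b nu :
  strip true (hook_part a b.+1) nu <->
  exists i c, [/\ (i <= a)%N, (b <= c <= b.+1)%N & nu = hook_part i c].
Proof.
split=> [/stripP[h1 h2]|[i [c [le_i /andP[le1 le2] ->]]]]; last first.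
  apply/stripP; split=> -[|r]; rewrite !nth_hook_part //=.
    by case: (ltnP r c) => // lt_r; rewrite (leq_trans lt_r).
  by rewrite ltnS; case: (ltnP r b) => // lt_r; rewrite (leq_trans lt_r).
have := h1 0%N; have := h2 0%N; rewrite !nth_hook_part /= => g1 g2.
(* Row b + 1 holds the last cell of the leg, so the entry of [nu] there is 1 if this cell is kept
   and 0 if it is removed. *)
exists (nth 0 nu 0).-1%N; exists (b + nth 0 nu b.+1)%N.
have := h1 b.+1; rewrite nth_hook_part /= leqnn => g3.
split; [by lia | by apply/andP; split; lia |].
apply: part_ext => r; rewrite nth_hook_part.
case: (eqVneq r 0%N) => [->|r0]; first by rewrite prednK.
have := h1 r; have := h2 r; rewrite !nth_hook_part (negPf r0) /= ltnS => g4 g5.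
case: (ltngtP r b.+1) => [lt_r|gt_r|->].
- have le_r : (r <= b)%N by [].
  by move: g4 g5; rewrite le_r (leqW le_r) (leq_trans le_r) ?leq_addr //; lia.
- have le_b : (r <= b.+1)%N = false by rewrite leqNgt gt_r.
  move: g5; rewrite le_b leqn0 => /eqP ->.
  by rewrite leqNgt (leq_ltn_trans _ gt_r) // -[X in (_ <= X)%N]addn1 leq_add2l.
by case: (nth 0%N nu b.+1) g3 => [|[|//]] _; rewrite ?addn0 ?addn1 ?ltnn ?leqnn.
Qed.

Lemma hookf_sum N a b : hookf N.+1 a b.+1 =
  \sum_(i < a.+1) x N ^+ (a - i) * (hookf N i b.+1 + x N * hookf N i b).
Proof.
rewrite /hookf tabsum_branch ?part_sub0 // ltnSn /=.
rewrite -(big_mkord xpredT (fun i => x N ^+ (a - i) *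
  (tabsum N N (hook_part i b.+1) empty_part x +
   x N * tabsum N N (hook_part i b) empty_part x))).
pose s c := [seq hook_part i c | i <- index_iota 0 a.+1].
have us c : uniq (s c).
  by rewrite map_inj_uniq ?iota_uniq // => i j /hook_part_inj[].
rewrite -big_filter (perm_big (s b.+1 ++ s b)); last first.
  apply: uniq_perm; first exact/filter_uniq/subparts_uniq.
    rewrite cat_uniq !us andbT; apply/hasPn => nu /mapP[i _ ->].
    by apply/mapP => -[j _ /hook_part_inj[_]]; lia.
  move=> nu; rewrite mem_filter mem_subparts mem_cat.
  apply/andP/orP => [[/hook_strip[i [c [le_i /andP[le1 le2] ->]]] _]|].
    have i_in : i \in index_iota 0 a.+1 by rewrite mem_index_iota ltnS.
    move: le2; rewrite leq_eqVlt ltnS => /orP[/eqP ->|le2].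
      by left; apply/mapP; exists i.
    have -> : c = b by apply/eqP; rewrite eqn_leq le2.
    by right; apply/mapP; exists i.
  have ok i c : (i <= a)%N -> (b <= c <= b.+1)%N ->
      strip true (hook_part a b.+1) (hook_part i c).
    by move=> h1 h2; apply/hook_strip; exists i, c.
  by case=> /mapP[i]; rewrite mem_index_iota ltnS /= => le_i ->;
     have h := ok i _ le_i; split; rewrite ?(strip_sub (h _ _)) ?h ?leqnn ?leqnSn.
rewrite big_cat; etransitivity; first by rewrite !big_map; apply/esym/big_split.
rewrite /= big_nat [RHS]big_nat.
apply: eq_bigr => i /andP[_]; rewrite ltnS => le_i.
have -> : (sumn (hook_part a b.+1) - sumn (hook_part i b.+1) = a - i)%N.
  by rewrite !sumn_hook_part; lia.
have -> : (sumn (hook_part a b.+1) - sumn (hook_part i b) = (a - i).+1)%N.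
  by rewrite !sumn_hook_part; lia.
by rewrite !(tabsum_all _ _ _ (leqnSn N)) exprSr mulrDr mulrA.
Qed.

Lemma hookf_row N a : hookf N a 0 = hsf x N a.+1.
Proof. by rewrite /hookf hook_part0. Qed.

(** The sum in [hookf_sum] for [a.+1] is its last term plus [x N] times the sum for [a]. *)
Lemma hookfSS N a b : hookf N.+1 a.+1 b.+1 =
  hookf N a.+1 b.+1 + x N * hookf N a.+1 b + x N * hookf N.+1 a b.+1.
Proof.
rewrite !hookf_sum big_ord_recr /= subnn mul1r addrC; congr (_ + _).
rewrite mulr_sumr; apply: eq_bigr => i _.
by rewrite [RHS]mulrA -exprS subSn // -ltnS.
Qed.

Lemma hookf0S N b : hookf N.+1 0 b.+1 = hookf N 0 b.+1 + x N * hookf N 0 b.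
Proof. by rewrite hookf_sum big_ord1 mul1r. Qed.

(** This is k_(n+1), as [hook_part a b] has a + b + 1 cells. *)
Definition hooksum N n : A := \sum_(b < n.+1) hookf N (n - b) b.

Lemma hooksumS N n : hooksum N.+1 n.+1 =
  hooksum N n.+1 + x N * hooksum N n + x N * hooksum N.+1 n.
Proof.
(* The three terms of [hookfSS], with the boundary cases built in: [t] vanishes at b = 0, where the
   hook is a row, and [u] at b = n + 1, where it is a column. *)
pose s (b : nat) := hookf N (n.+1 - b) b.
pose t (b : nat) := if b is b'.+1 then x N * hookf N (n - b') b' else 0.
pose u (b : nat) := if (b <= n)%N then x N * hookf N.+1 (n - b) b else 0.
rewrite {1}/hooksum (eq_bigr (fun b : 'I_n.+2 => s b + t b + u b)) => [|b _].
  rewrite !big_split /=; congr (_ + _ + _).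
    by rewrite big_ord_recl /= add0r mulr_sumr; apply: eq_bigr.
  rewrite big_ord_recr /= /u ltnn addr0 mulr_sumr; apply: eq_bigr => b _.
  by rewrite -ltnS ltn_ord.
rewrite /s /t /u; case: b => -[|b] lt_b /=.
  by rewrite !subn0 !hookf_row hsfS addr0.
rewrite subSS; move: lt_b; rewrite !ltnS leq_eqVlt => /orP[/eqP->|lt_b].
  by rewrite subnn ltnn addr0 hookf0S.
by rewrite lt_b -(subnSK lt_b) hookfSS.
Qed.

Definition hesum N n : A := \sum_(j < n.+1) hsf x N j * esf x N (n - j).

Lemma hesum0 N : hesum N 0 = 1.
Proof. by rewrite /hesum big_ord1 hsf0 esf0 mulr1. Qed.

(** [hesum] gives the coefficients of H(t) E(t), and a new variable x multiplies this series by (1 +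
    x t) / (1 - x t). *)
Lemma hesumS N n : hesum N.+1 n.+1 =
  hesum N n.+1 + x N * hesum N n + x N * hesum N.+1 n.
Proof.
have e1 : hesum N.+1 n.+1 = \sum_(j < n.+2) hsf x N j * esf x N.+1 (n.+1 - j) +
    x N * hesum N.+1 n.
  rewrite /hesum big_ord_recl [in RHS]big_ord_recl !hsf0 -addrA; congr (_ + _).
  rewrite mulr_sumr -big_split; apply: eq_bigr => j _.
  by rewrite !lift0 subSS hsfS mulrDl mulrA.
rewrite e1; congr (_ + _); rewrite /hesum big_ord_recr [in RHS]big_ord_recr /= subnn !esf0.
rewrite addrAC; congr (_ + _); rewrite mulr_sumr -big_split; apply: eq_bigr => j _ /=.
by rewrite subSn -1?ltnS //= mulrDr [x N * (_ * _)]mulrCA.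
Qed.

(** Both families satisfy the same recurrence. The factor 2 arises in degree 1, where [hesum] starts
    from the value 1 in degree 0 and each variable enters through h_1 and through e_1. *)
Lemma hesum_hooksum N n : hesum N n.+1 = hooksum N n *+ 2.
Proof.
elim: N n => [|N IHN] n.
  rewrite /hooksum big1 => [|b _]; last by rewrite /hookf tabsum0 ?part_sub0.
  rewrite mul0rn /hesum big1 // => -[[|j] lt_j] _; first by rewrite mulr0.
  by rewrite hsf0n mul0r.
elim: n => [|n IHn]; last by rewrite hesumS IHn !IHN hooksumS !mulrnDl !mulrnAr.
rewrite hesumS IHN !hesum0 /hooksum !big_ord1 !hookf_row hsfS hsf0 mulrnDl.
by rewrite -addrA mulr2n.
Qed.

End Hooks.

Lemma DS_row n : DS (row_part n.+1) = k_fun n.+1 *+ 2.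
Proof.
apply: symfun_eq => N; rewrite symfunMnE /DS /k_fun !symfun_sumE big_subparts_row.
rewrite [in RHS](eq_bigr (fun b : 'I_n.+1 => hookf (xvar N) N (n - b) b)); last first.
  by move=> b _; rewrite subSn -1?ltnS // schurE.
rewrite -[\sum_(b < n.+1) _]/(hooksum (xvar N) N n) -hesum_hooksum.
apply: eq_bigr => m _; have le_m : (m <= n.+1)%N by rewrite -ltnS.
rewrite -[LHS]/(schur (row_part m) N *
  skew_schur (conj_part (row_part n.+1)) (conj_part (row_part m)) N).
rewrite schur_rowE skew_schurE ?conj_part_sub ?row_part_sub //.
by rewrite -conj_tabsum esf_tabsum.
Qed.

(** * The doubling map *)

(** Merges repeated partitions, so that the coefficient becomes a function of the partition as
    [doubly_symmetric] requires. *)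
Lemma sum_by_part (V : lmodType rat) (B : part -> V) (s : seq (rat * part)) :
  \sum_(t <- s) t.1 *: B t.2 =
  \sum_(la <- undup (map snd s)) (\sum_(t <- s | t.2 == la) t.1) *: B la.
Proof.
under [RHS]eq_bigr do rewrite scaler_suml.
rewrite (exchange_big_dep predT) //= big_seq [RHS]big_seq; apply: eq_bigr => t t_s.
rewrite -big_filter (_ : [seq _ <- _ | _] = [:: t.2]) ?big_seq1 //.
have -> : [seq la <- undup (map snd s) | t.2 == la] =
    [seq la <- undup (map snd s) | pred1 t.2 la].
  by apply: eq_filter => la; rewrite /= eq_sym.
by rewrite filter_pred1_uniq ?undup_uniq // mem_undup map_f.
Qed.

Lemma homog_lin d (a : rat) f g :
  homogeneous d f -> homogeneous d g -> homogeneous d (a *: f + g).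
Proof. by move=> hf hg n; apply: rpredD; [apply: rpredZ; apply: hf | apply: hg]. Qed.

Lemma homog0 d : homogeneous d 0.
Proof. by move=> n; apply: rpred0. Qed.

Lemma homog_sum d (I : eqType) (s : seq I) (a : I -> rat) (u : I -> symfun) :
  {in s, forall i, homogeneous d (u i)} -> homogeneous d (\sum_(i <- s) a i *: u i).
Proof.
elim: s => [|i s IHs] hu; first by rewrite big_nil; apply: homog0.
rewrite big_cons; apply: homog_lin; first exact/hu/mem_head.
by apply: IHs => j js; apply: hu; rewrite inE js orbT.
Qed.

Lemma star_sumr d star (I : eqType) (s : seq I) (a : I -> rat) (u : I -> symfun) h :
  internal_product d star -> homogeneous d h ->
  {in s, forall i, homogeneous d (u i)} ->
  star h (\sum_(i <- s) a i *: u i) = \sum_(i <- s) a i *: star h (u i).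
Proof.
move=> [_ _ linr _] hh; elim: s => [|i s IHs] hu; rewrite ?big_nil ?big_cons.
  (* Linearity applied to [1 *: 0 + 0] gives [star h 0 = 0]. *)
  have := linr 1 _ _ _ (@homog0 d) (@homog0 d) hh; rewrite !scale1r addr0.
  by move=> e; apply: (addrI (star h 0)); rewrite addr0 -e.
have hs : {in s, forall j, homogeneous d (u j)}.
  by move=> j js; apply: hu; rewrite inE js orbT.
by rewrite linr ?IHs //; [apply/hu/mem_head | apply: homog_sum].
Qed.

(** The opposite of an internal product is again an internal product. *)
Lemma star_suml d star (I : eqType) (s : seq I) (a : I -> rat) (u : I -> symfun) h :
  internal_product d star -> homogeneous d h ->
  {in s, forall i, homogeneous d (u i)} ->
  star (\sum_(i <- s) a i *: u i) h = \sum_(i <- s) a i *: star (u i) h.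
Proof.
move=> [h1 linl linr h2]; apply: (@star_sumr d (fun f g => star g f)).
split=> //; first by move=> f g hf hg; apply: h1.
by move=> la mu hla hmu; rewrite h2 // eq_sym; case: eqP => // ->.
Qed.

Lemma opp_exprNS (A : comNzRingType) (y : A) r :
  - (- y) ^+ r.+1 = (-1) ^+ r * y ^+ r.+1.
Proof. by rewrite (exprNn y) [(-1) ^+ r.+1]exprS mulN1r mulNr opprK. Qed.

Section Doubling.

Variables (D : {linear symfun -> symfun})
  (F : forall k l : nat, {linear symfun -> {mpoly rat[k + l]}}).
Hypotheses (D_schur : forall la : part, D (schur la) = DS la)
  (F_schur : forall (k l : nat) (la : part), F k l (schur la) = HS k l la).

(** For [N < k] no letter is primed, and evaluation in [N] variables serves as the map. *)
Lemma super_ex k N : exists G : {linear symfun -> {mpoly rat[N]}},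
  forall la, G (schur la) = tab_poly N k la empty_part.
Proof.
have [le_kN|lt_Nk] := leqP k N.
  have e : N = (k + (N - k))%N by rewrite subnKC.
  by move: (N - k)%N e => l ->; exists (F k l) => la; apply: F_schur.
exists (sym_at N) => la; rewrite tab_polyE tabsum_all ?(ltnW lt_Nk) //.
exact: sym_at_schur.
Qed.

Lemma F_mul k l f g : F k l (f * g) = F k l f * F k l g.
Proof. exact: (super_mul (super_ex k) (F_schur k l)). Qed.

Lemma F_one k l : F k l 1 = 1.
Proof. exact: (super_one (F_schur k l)). Qed.

Lemma F_psum k l r : F k l (psum r) =
  \sum_(i < k + l) (if (i < k)%N then 'X_i ^+ r.+1 else - (- 'X_i) ^+ r.+1).
Proof. exact: (super_psum (super_ex k) r (F_schur k l)). Qed.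

Definition fold_vars n : (n + n).-tuple {mpoly rat[n]} :=
  [tuple (match split i with inl j => 'X_j | inr j => 'X_j end) | i < n + n].

Lemma D_diag f n : D f n = diag (F n n f).
Proof.
pose G1 : {linear symfun -> {mpoly rat[n]}} := sym_at n \o D.
pose G2 : {linear symfun -> {mpoly rat[n]}} := comp_mpoly (fold_vars n) \o F n n.
apply: (schur_linear_eq (G := G1) (G' := G2)) => la.
by rewrite /G1 /G2 /= D_schur F_schur; apply: DS_diag.
Qed.

Lemma D_mul f g : D (f * g) = D f * D g.
Proof.
apply: symfun_eq => n; rewrite -[RHS]/(D f n * D g n) !D_diag F_mul.
exact: (rmorphM (comp_mpoly (fold_vars n))).
Qed.

Lemma D_one : D 1 = 1.
Proof. by apply: symfun_eq => n; rewrite D_diag F_one; apply: comp_mpoly1. Qed.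

(** As [psum r] has degree r + 1, the factor is 2 in odd degree and 0 in even degree. *)
Lemma D_psum r : D (psum r) = (1 + (-1) ^+ r) *: psum r.
Proof.
apply: symfun_eq => n; rewrite D_diag F_psum.
rewrite -[RHS]/((1 + (-1) ^+ r) *: \sum_(i < n) 'X_i ^+ r.+1).
rewrite /diag -/(fold_vars n) (raddf_sum (comp_mpoly (fold_vars n))) big_split_ord /=.
have foldE i : 'X_i \mPo fold_vars n =
    match split i with inl j => 'X_j | inr j => 'X_j end.
  by rewrite comp_mpolyXU -tnth_nth tnth_mktuple.
rewrite scalerDl scale1r scaler_sumr; congr (_ + _); apply: eq_bigr => i _.
  rewrite ltn_ord (rmorphXn (comp_mpoly (fold_vars n))) /= foldE.
  by rewrite -[lshift n i]/(unsplit (inl i)) unsplitK.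
rewrite ltnNge leq_addr /= comp_mpolyN (rmorphXn (comp_mpoly (fold_vars n))) /=.
rewrite comp_mpolyN foldE.
rewrite -[rshift n i]/(unsplit (inr i)) unsplitK opp_exprNS.
by rewrite -!mul_mpolyC rmorphXn rmorphN1.
Qed.

Lemma D_psum_part la :
  D (psum_part la) = (\prod_(a <- la) (1 + (-1) ^+ a.-1)) *: psum_part la.
Proof.
rewrite /psum_part; elim: (la : seq nat) => [|a s IHs].
  by rewrite !big_nil D_one scale1r.
by rewrite !big_cons D_mul IHs D_psum -scalerAl -scalerAr scalerA.
Qed.

(** It suffices to treat one power sum. In odd degree primed and unprimed letters contribute with
    the same sign, so superization is evaluation in all variables; in even degree [D] already gives
    zero. *)
Lemma F_D k l f : F k l (D f) = D f (k + l)%N.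
Proof.
have [d /psum_span[s _ ->]] := symfun_deg f.
rewrite -[RHS]/(sym_at (k + l) (D _)) !linear_sum; apply: eq_bigr => -[a la] _ /=.
rewrite !(linearZZ D) (linearZZ (F k l)) (linearZZ (sym_at (k + l))); congr (_ *: _).
rewrite /psum_part; elim: (la : seq nat) => [|b t IHt].
  by rewrite big_nil D_one F_one rmorph1.
rewrite big_cons D_mul F_mul IHt -[RHS]/(sym_at (k + l) (D (psum b.-1)) * sym_at (k + l) (D _)).
congr (_ * _); rewrite D_psum.
rewrite (linearZZ (F k l)) F_psum.
rewrite -[RHS]/((1 + (-1) ^+ b.-1) *: \sum_(i < k + l) 'X_i ^+ b.-1.+1) !scaler_sumr.
apply: eq_bigr => i _; case: ifP => // _; rewrite opp_exprNS.
rewrite -[X in 1 + X]signr_odd -[X in _ *: (X * _)]signr_odd.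
by case: odd; rewrite ?expr1 ?subrr ?scale0r // !expr0 mul1r.
Qed.

Lemma doubly_symmetricP f : (forall k l, F k l f = f (k + l)%N) -> doubly_symmetric f.
Proof.
move=> Ff; have [d /schur_span[s _ es]] := symfun_deg f; rewrite sum_by_part in es.
exists (undup (map snd s)), (fun la => \sum_(t <- s | t.2 == la) t.1); split=> // k l.
transitivity (f (k + l)%N); first by rewrite es symfun_sumE.
rewrite -Ff es linear_sum; apply: eq_bigr => la _.
by rewrite linearZ F_schur.
Qed.

(** Applying [D] to the power sum expansion of h_n expresses 2 k_n through the eigenvalues of [D].
    The product with p_la then selects the term of la, and the two occurrences of z_la cancel. *)
Lemma D_star n star f : (1 <= n)%N -> internal_product n star ->
  homogeneous n f -> D f = star f (k_fun n *+ 2).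
Proof.
case: n => // n _ hs hf; have [_ _ _ star_p] := hs.
have [s /allP all_s ->] := psum_span_homog hf.
pose w (la : part) := (zcoef la)%:R^-1 * \prod_(a <- la) (1 + (-1) ^+ a.-1) : rat.
have e2k : k_fun n.+1 *+ 2 =
    \sum_(la <- parts_of n.+1) w la *: psum_part la.
  rewrite -DS_row -D_schur schur_row_zsum linear_sum; apply: eq_bigr => la _.
  by rewrite (linearZZ D) D_psum_part scalerA.
rewrite e2k linear_sum.
have hp (la : part) : sumn la = n.+1 -> homogeneous n.+1 (psum_part la).
  by move=> e; rewrite -e; apply: psum_part_homog.
have hparts : {in parts_of n.+1, forall la, homogeneous n.+1 (psum_part la)}.
  by move=> la; rewrite mem_parts_of => /eqP /hp.
rewrite (star_suml _ hs); [|exact: homog_sum|]; last by move=> t /all_s /eqP /hp.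
rewrite big_seq [RHS]big_seq; apply: eq_bigr => -[a la] /all_s /= /eqP e.
rewrite (linearZZ D) D_psum_part (star_sumr _ hs (hp _ e) hparts); congr (_ *: _).
rewrite (bigD1_seq la) ?parts_of_uniq ?mem_parts_of ?e //= star_p // eqxx.
rewrite [X in _ + X]big_seq_cond [X in _ + X]big1 ?addr0 => [|mu /andP[]]; last first.
  rewrite mem_parts_of => /eqP e' ne; rewrite star_p // eq_sym (negPf ne).
  by rewrite scaler0.
rewrite -scaler_nat scalerA /w mulrAC mulVf ?mul1r // pnatr_eq0 -lt0n.
exact: zcoef_gt0.
Qed.

End Doubling.

Theorem lemma2p8
    (D : {linear symfun -> symfun})
    (D_schur : forall la : part, D (schur la) = DS la)
    (F : forall k l : nat, {linear symfun -> {mpoly rat[k + l]}})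
    (F_schur : forall (k l : nat) (la : part), F k l (schur la) = HS k l la) :
  (* (1) *)
  (forall n : nat, (1 <= n)%N -> DS (row_part n) = k_fun n *+ 2) /\
  (* (2) *)
  ((forall (la : part) (n : nat), DS la n = diag (HS n n la)) /\
   (forall (f : symfun) (n : nat), D f n = diag (F n n f))) /\
  (* (3) *)
  ((forall la : part, doubly_symmetric (DS la)) /\
   (forall f : symfun, doubly_symmetric (D f))) /\
  (* (4) *)
  (D 1 = 1 /\ forall f g : symfun, D (f * g) = D f * D g) /\
  (* (5) *)
  (forall (n : nat) (star : symfun -> symfun -> symfun),
     (1 <= n)%N -> internal_product n star ->
     forall f : symfun, homogeneous n f -> D f = star f (k_fun n *+ 2)).
Proof.
split; first by case=> // n _; apply: DS_row.
split; first by split; [exact: DS_diag | exact: (D_diag D_schur F_schur)].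
have sym_D f : doubly_symmetric (D f).
  by apply: (doubly_symmetricP F_schur) => k l; apply: (F_D D_schur F_schur).
split; first by split=> // la; rewrite -D_schur.
split; first by split; [exact: (D_one D_schur F_schur) | exact: (D_mul D_schur F_schur)].
by move=> n star n_gt0 h_star f; apply: (D_star D_schur F_schur n_gt0 h_star).
Qed.
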